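(* Let $1<p<\infty$ and $\beta>p-1$. Then $$W^{1,p}(\mathbb{R}_+,t^\beta)=W_0^{1,p}(\mathbb{R}_+,t^\beta)=\mathcal{A}^\infty_{p,t^\beta}=\mathcal{B}^\infty_{p,t^\beta}=\mathcal{C}^\infty_{p,t^\beta}=Y^{1,p}_{t^\beta}.$$ In particular, the trace operator $Tr^\infty(u):=\lim_{t\to\infty}u(t)$ annihilates the whole space $W^{1,p}(\mathbb{R}_+,t^\beta)$ (that is, the limit exists and equals $0$ for every $u$ in this space). Moreover, $$\lim_{t\to\infty}t^{\frac{\beta-(p-1)}{p}}|u(t)|=0\quad\text{for every }u\in W^{1,p}(\mathbb{R}_+,t^\beta).$$
   Context: $\mathbb{R}_+=(0,\infty)$; functions are real valued. For $1\le p<\infty$ and $\beta\in\mathbb{R}$: $W^{1,p}(\mathbb{R}_+,t^\beta)$ is the Banach space of all $u\in W^{1,1}_{loc}(\mathbb{R}_+)$ with finite norm $$\|u\|_{W^{1,p}(\mathbb{R}_+,t^\beta)}=\Big(\int_{\mathbb{R}_+}|u(t)|^pt^\beta dt\Big)^{1/p}+\Big(\int_{\mathbb{R}_+}|u'(t)|^pt^\beta dt\Big)^{1/p}.$$ $Y^{1,p}_{t^\beta}$ is the Banach space of all $u\in W^{1,1}_{loc}(\mathbb{R}_+)$ with finite norm $$\|u\|_{Y^{1,p}_{t^\beta}}=\Big(\int_{\mathbb{R}_+}|u(t)|^pt^\beta\big(1+\tfrac{1}{t^p}\big)dt\Big)^{1/p}+\Big(\int_{\mathbb{R}_+}|u'(t)|^pt^\beta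 dt\Big)^{1/p}.$$ Elements of $W^{1,1}_{loc}(\mathbb{R}_+)$ are identified with their continuous representatives on $\mathbb{R}_+$. $W_0^{1,p}(\mathbb{R}_+,t^\beta)$ denotes the completion (closure) of $C_0^\infty(\mathbb{R}_+)$, the smooth functions with compact support in $(0,\infty)$, in $W^{1,p}(\mathbb{R}_+,t^\beta)$. Define the sets $$\mathcal{A}^\infty_{p,t^\beta}=\{u\in W^{1,p}(\mathbb{R}_+,t^\beta):\ \text{there exists } t_n\nearrow\infty \text{ with } \lim_{n\to\infty}u(t_n)=0\},$$ $$\mathcal{B}^\infty_{p,t^\beta}=\{u\in W^{1,p}(\mathbb{R}_+,t^\beta):\ \lim_{t\to\infty}u(t)=0\},$$ $$\mathcal{C}^\infty_{p,t^\beta}=\{u\in W^{1,p}(\mathbb{R}_+,t^\beta):\ \lim_{t\to\infty}u(t)\,t^{(\beta-p+1)/p}=0\}.$$ All equalities between spaces are as sets of functions. *)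

(* Defs.v *)
From HB Require Import structures.
From mathcomp Require Import all_boot all_order all_algebra.
From mathcomp Require Import all_classical all_reals all_analysis.
Set Implicit Arguments.
Unset Strict Implicit.
Unset Printing Implicit Defensive.
Import Order.TTheory GRing.Theory Num.Theory.
Import numFieldNormedType.Exports.
Local Open Scope classical_set_scope.
Local Open Scope ring_scope.

(* A function on R_+ = (0, +oo) is represented by a total function R -> R.
   Membership in each of the function spaces below other than [C0infty] depends
   only on the restriction to R_+, so that equality of these sets of total
   functions is equality of the corresponding sets of functions on R_+.
   Elements of [C0infty] are extended by 0 outside R_+. *)

Definition Rpos (R : realType) : set R := `]0, +oo[%classic.
Arguments Rpos R : clear implicits.

Definition C0infty (R : realType) : set (R -> R) :=
  [set phi : R -> R | [/\ (forall n (t : R), derivable (derive1n n phi) t 1),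
                 compact (closure [set t | phi t != 0]) &
                 closure [set t | phi t != 0] `<=` Rpos R]].

(* Distributional derivative on R_+. *)
Definition is_weak_derive (R : realType) (u g : R -> R) : Prop :=
  locally_integrable (Rpos R) g /\
  forall phi : R -> R, C0infty phi ->
    \int[lebesgue_measure]_(t in Rpos R) (u t * derive1 phi t) =
    - \int[lebesgue_measure]_(t in Rpos R) (g t * phi t).

(* The continuity condition selects the continuous representative. *)
Definition W11loc (R : realType) : set (R -> R) :=
  [set u | [/\ locally_integrable (Rpos R) u,
               (forall t, Rpos R t -> {for t, continuous u}) &
               exists g, is_weak_derive u g]].

(* A weak derivative of u; it is unique up to a null subset of R_+. *)
Definition weak_derive (R : realType) (u : R -> R) : R -> R :=
  xget (cst 0) [set g | is_weak_derive u g].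

Definition Wnorm (R : realType) (p b : R) (u : R -> R) : \bar R :=
  ((\int[lebesgue_measure]_(t in Rpos R) (`|u t| `^ p * t `^ b)%:E) `^ p^-1
   + (\int[lebesgue_measure]_(t in Rpos R)
        (`|weak_derive u t| `^ p * t `^ b)%:E) `^ p^-1)%E.

Definition Wspace (R : realType) (p b : R) : set (R -> R) :=
  [set u | W11loc u /\ (Wnorm p b u < +oo)%E].

Definition Ynorm (R : realType) (p b : R) (u : R -> R) : \bar R :=
  ((\int[lebesgue_measure]_(t in Rpos R)
      (`|u t| `^ p * t `^ b * (1 + 1 / t `^ p))%:E) `^ p^-1
   + (\int[lebesgue_measure]_(t in Rpos R)
        (`|weak_derive u t| `^ p * t `^ b)%:E) `^ p^-1)%E.

Definition Yspace (R : realType) (p b : R) : set (R -> R) :=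
  [set u | W11loc u /\ (Ynorm p b u < +oo)%E].

Definition W0space (R : realType) (p b : R) : set (R -> R) :=
  [set u | Wspace p b u /\
     forall e : R, 0 < e ->
       exists2 phi : R -> R, C0infty phi & (Wnorm p b (u \- phi)%R < e%:E)%E].

Definition Ainfty (R : realType) (p b : R) : set (R -> R) :=
  [set u | Wspace p b u /\
     exists s : nat -> R,
       [/\ (forall n, Rpos R (s n)), nondecreasing_seq s,
           s n @[n --> \oo] --> +oo & u (s n) @[n --> \oo] --> (0 : R)]].

Definition Binfty (R : realType) (p b : R) : set (R -> R) :=
  [set u | Wspace p b u /\ u t @[t --> +oo] --> (0 : R)].

Definition Cinfty (R : realType) (p b : R) : set (R -> R) :=
  [set u | Wspace p b u /\
     u t * t `^ ((b - p + 1) / p) @[t --> +oo] --> (0 : R)].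

Definition Trinfty (R : realType) (u : R -> R) : R := lim (u t @[t --> +oo]).

(* Main.v *)
Require Import Defs.
From HB Require Import structures.
From mathcomp Require Import all_boot all_order all_algebra.
From mathcomp Require Import all_classical all_reals all_analysis.
From mathcomp Require Import measurable_realfun ring lra.
Import Order.TTheory GRing.Theory Num.Theory.
Import numFieldNormedType.Exports.
Local Open Scope classical_set_scope.
Local Open Scope ring_scope.

(**
  Let [u] have finite weighted norm, with weak derivative [g], and put
  [kappa = b - p + 1 > 0].  The energy of a function on an interval is the
  integral of the [p]-th power of its absolute value with weight [t^b].

  Testing the definition of the weak derivative against smooth approximations
  of the indicator of [`]s, t]] gives [u t - u s = \int_(]s, t]) g]
  ([weak_derive_FTC]), and Lebesgue differentiation then makes the weak
  derivative unique almost everywhere ([weak_derive_unique]).  On a dyadic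
  interval [`]s, 2s]] the Hoelder inequality turns this into the scale-invariant
  bound [s^kappa |u t - u s|^p <= 2^p I(s)], where [I(s)] is the energy of [g]
  on that interval ([wfun_oscillation]).

  Decay at infinity ([wfun_decay]).  For [1 <= s] the oscillation bound is
  averaged over [`]s, s + 1]]: [s^kappa |u s|^p] is at most a constant times
  the energy of [u] and [g] beyond [s], a tail of a convergent integral.  Hence
  [t^(kappa / p) |u t|] tends to 0, which contains all the statements on limits
  at infinity.

  Hardy's inequality ([hardy]).  Halving [s] multiplies [s^kappa |u s|^p] by a
  ratio smaller than 1, up to an error [C I(s)] ([hardy_step]).  So the integral
  of [|u|^p t^(b - p)] over [`]s, 1]], corrected by suitable multiples of
  [s^kappa |u s|^p] and of the energy of [g] over [`]s, 1]], cannot increase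
  when [s] is halved; it is therefore bounded as [s] tends to 0.  This is the
  inclusion into the space normed by [Ynorm]; the converse inclusion is a
  comparison of the integrands.

  Density of the test functions ([wfun_density]).  Hardy's inequality controls
  the cut-off near 0 as well as near infinity, because the derivative of the
  cut-off is [O(1 / t)] at both ends ([cutoff_approx]).  On the compact interval
  that remains, [g] is approximated in [L^p] by a smooth [k] ([Lp_approx]); the
  antiderivative [P] of [k] that agrees with [u] at the left endpoint is then
  uniformly close to [u], and the cut-off of [P] is the required test function.
*)

Set Implicit Arguments.
Unset Strict Implicit.

(** * Smooth functions and a smooth step *)

Section SmoothFunctions.
Context {R : realType}.
Implicit Types (f g : R -> R) (n : nat).

Definition smooth f := forall n (t : R), derivable (derive1n n f) t 1.

(** Differentiability of finite order, with the derivative as an explicit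
    witness: unlike iterates of [derive1], this form is stable under sums,
    products, inverses and affine substitutions by induction on the order. *)
Inductive diffn : nat -> (R -> R) -> Prop :=
| diffn0 f f' : (forall t : R, is_derive t 1 f (f' t)) -> diffn 0 f
| diffnS n f f' : (forall t : R, is_derive t 1 f (f' t)) -> diffn n f' ->
    diffn n.+1 f.

Lemma diffn_inv n f : diffn n f ->
  exists2 f', (forall t : R, is_derive t 1 f (f' t)) & diffn n.-1 f' \/ n = 0.
Proof. by case=> [g g' dg|m g g' dg d]; exists g' => //; [right|left]. Qed.

Lemma derive1_is_derive f f' : (forall t : R, is_derive t 1 f (f' t)) ->
  derive1 f = f'.
Proof. by move=> df; apply/funext => t; rewrite derive1E; have [_ ->] := df t. Qed.

Lemma smooth_diffn f : smooth f <-> forall n, diffn n f.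
Proof.
split.
- have der g (t : R) : smooth g -> is_derive t 1 g (derive1 g t).
    by move=> sg; rewrite derive1E; apply: derivableP; exact: (sg 0).
  move=> + n; elim: n f => [|n IH] f sf; first exact: (diffn0 (fun t => der f t sf)).
  apply: (diffnS (fun t => der f t sf)).
  by apply: IH => m t; rewrite -derive1Sn; exact: sf.
- move=> df n t; have {df} := df n.
  elim: n f => [|n IH] f /diffn_inv[f' df d'].
    by have [] := df t.
  by case: d' => // d'; rewrite derive1Sn (derive1_is_derive df); exact: IH.
Qed.

Lemma diffnW n f : diffn n.+1 f -> diffn n f.
Proof.
elim: n f => [|n IH] f /diffn_inv[f' df [] // d']; first exact: diffn0 df.
by apply: (diffnS df); exact: IH.
Qed.

(** Differentiation rules in pointwise form, which is how the functions below are
    written; the sums and products of the ring of functions do not unify with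
    it. *)
Lemma is_derive_addf f g (t a b : R) : is_derive t 1 f a -> is_derive t 1 g b ->
  is_derive t 1 (fun x => f x + g x) (a + b).
Proof. by move=> df dg; exact: is_deriveD. Qed.

Lemma is_derive_mulf f g (t a b : R) : is_derive t 1 f a -> is_derive t 1 g b ->
  is_derive t 1 (fun x => f x * g x) (a * g t + f t * b).
Proof.
move=> df dg; rewrite addrC [a * _]mulrC; exact: (@is_deriveM _ _ f g).
Qed.

Lemma is_derive_invf f (t a : R) : f t != 0 -> is_derive t 1 f a ->
  is_derive t 1 (fun x => (f x)^-1) (- a * (f t)^-1 * (f t)^-1).
Proof.
move=> f0 [df dE]; apply: DeriveDef; first exact: derivableV.
rewrite deriveV// dE.
by rewrite -exprVn expr2 /GRing.scale/=; ring.
Qed.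

Lemma diffn_cst n (c : R) : diffn n (cst c).
Proof.
have dc (k : R) (t : R) : is_derive t 1 (cst k : R -> R) (cst 0 t).
  exact: is_derive_cst.
by elim: n c => [|n IH] c; [exact: diffn0 (dc c)|exact: diffnS (dc c) (IH 0)].
Qed.

Lemma diffnD n f g : diffn n f -> diffn n g -> diffn n (fun x => f x + g x).
Proof.
elim: n f g => [|n IH] f g /diffn_inv[f' df d1] /diffn_inv[g' dg d2].
  exact: diffn0 (fun t => is_derive_addf (df t) (dg t)).
case: d1 => // d1; case: d2 => // d2.
exact: diffnS (fun t => is_derive_addf (df t) (dg t)) (IH _ _ d1 d2).
Qed.

Lemma diffnM n f g : diffn n f -> diffn n g -> diffn n (fun x => f x * g x).
Proof.
elim: n f g => [|n IH] f g Df Dg.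
  move: Df Dg => /diffn_inv[f' df _] /diffn_inv[g' dg _].
  exact: diffn0 (fun t => is_derive_mulf (df t) (dg t)).
have [f' df [] // d1] := diffn_inv Df; have [g' dg [] // d2] := diffn_inv Dg.
apply: diffnS (fun t => is_derive_mulf (df t) (dg t)) _.
by apply: diffnD; apply: IH => //; exact: diffnW.
Qed.

Lemma diffnV n f : (forall t, f t != 0) -> diffn n f -> diffn n (fun t => (f t)^-1).
Proof.
move=> f0; elim: n => [|n IH] Df; have [f' df d1] := diffn_inv Df.
  exact: diffn0 (fun t => is_derive_invf (f0 t) (df t)).
case: d1 => // d1; have Vn := IH (diffnW Df).
apply: diffnS (fun t => is_derive_invf (f0 t) (df t)) _.
apply: diffnM => //; apply: diffnM => //.
have := diffnM (diffn_cst n (-1)) d1.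
by under eq_fun do rewrite /= mulN1r.
Qed.

Lemma is_derive_affine (a c t : R) : is_derive t 1 (fun x : R => a * x + c) a.
Proof.
have dZ : is_derive t 1 (fun x : R => a * x) a.
  by have := @is_deriveZ R R R id a t 1 1 (is_derive_id _ _); rewrite /GRing.scale/= mulr1.
have dc : is_derive t 1 (cst c : R -> R) 0 by exact: is_derive_cst.
by have := is_derive_addf dZ dc; rewrite addr0.
Qed.

Lemma diffn_affine n f (a c : R) : diffn n f -> diffn n (fun x => f (a * x + c)).
Proof.
have dcomp (h h' : R -> R) (t : R) : (forall t : R, is_derive t 1 h (h' t)) ->
    is_derive t 1 (fun x => h (a * x + c)) (h' (a * t + c) * a).
  by move=> dh; exact: (@is_derive1_comp _ h _ _ _ _ (dh _) (is_derive_affine a c t)).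
elim: n f => [|n IH] f /diffn_inv[f' df d1].
  exact: diffn0 (fun t => dcomp _ _ t df).
case: d1 => // d1; apply: diffnS (fun t => dcomp _ _ t df) _.
by apply: diffnM; [exact: IH|exact: diffn_cst].
Qed.

(** These functions vanish to infinite order at 0.  The negative power makes the
    family stable under derivation up to linear combinations
    ([flat_derive]), so that smoothness needs no general formula for the
    higher derivatives of [expR (- x^-1)]. *)
Definition flat (n : nat) (x : R) : R := if 0 < x then x ^- n * expR (- x^-1) else 0.

Lemma flat_ge0 n x : 0 <= flat n x.
Proof.
rewrite /flat; case: ifPn => // x0.
by rewrite mulr_ge0 ?expR_ge0// invr_ge0 exprn_ge0// ltW.
Qed.

(** The exponential dominates [y ^+ n.+1 / n.+1`!] at [y = x^-1]; this is what
    makes the difference quotients at 0 tend to 0. *)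
Lemma flat_le n (x : R) : 0 <= x -> flat n x <= n.+1`!%:R * x.
Proof.
move=> x0; rewrite /flat; case: ifPn => [{}x0|_]; last by rewrite mulr_ge0.
have xV : 0 <= x^-1 by rewrite invr_ge0 ltW.
have h : x ^- n.+1 / n.+1`!%:R <= expR x^-1.
  by apply: le_trans (expR_ge1Dxn n xV); rewrite -exprVn lerDr.
rewrite expRN ler_pdivrMr ?expR_gt0//.
have x1 : x != 0 by rewrite gt_eqF.
have f1 : n.+1`!%:R != 0 :> R by rewrite pnatr_eq0 -lt0n fact_gt0.
have k0 : 0 <= n.+1`!%:R * x by rewrite mulr_ge0 ?ltW.
have := ler_wpM2l k0 h; congr (_ <= _).
set F := _`!%:R in f1 *; rewrite exprS.
by field; rewrite f1 x1 expf_neq0.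
Qed.

Lemma flat_derive n (x : R) : is_derive x 1 (flat n) (flat n.+2 x - n%:R * flat n.+1 x).
Proof.
have [x0|x0|->] := ltgtP x 0.
- rewrite {2 3}/flat ltNge (ltW x0)/= mulr0 subr0.
  apply: (@near_eq_is_derive _ _ _ (cst 0)).
    near=> y; rewrite /flat ltNge [y <= 0]ltW//; near: y; exact: lt_nbhsl.
- have xn0 : x != 0 by rewrite gt_eqF.
  have xV : is_derive x 1 (fun y : R => y^-1) (- x^-1 * x^-1).
    by have := is_derive_invf xn0 (is_derive_id x 1); rewrite mulN1r.
  have xN : is_derive x 1 (fun y : R => - y^-1) (x^-1 * x^-1).
    by have := @is_deriveN _ _ _ _ _ _ _ xV; rewrite mulNr opprK.
  apply: (@near_eq_is_derive _ _ _ (fun y : R => (y ^-1) ^+ n * expR (- y^-1))).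
    near=> y; rewrite /flat ifT ?exprVn//; near: y; exact: lt_nbhsr.
  have xE : is_derive x 1 (fun y : R => expR (- y^-1)) (expR (- x^-1) * (x^-1 * x^-1)).
    exact: (@is_derive1_comp _ expR (fun y : R => - y^-1)).
  have xX : is_derive x 1 (fun y : R => (y^-1) ^+ n) ((n%:R * x^-1 ^+ n.-1) * (- x^-1 * x^-1)).
    apply: (@is_derive1_comp _ (fun y : R => y ^+ n) (fun y : R => y^-1)).
    by apply: DeriveDef; [exact: exprn_derivable|rewrite exp_derive /GRing.scale/= mulr1].
  have -> : flat n.+2 x - n%:R * flat n.+1 x =
      (n%:R * x^-1 ^+ n.-1) * (- x^-1 * x^-1) * expR (- x^-1) +
      x^-1 ^+ n * (expR (- x^-1) * (x^-1 * x^-1)); last exact: is_derive_mulf xX xE.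
  rewrite /flat x0 -!exprVn.
  case: n {xX} => [|n]; first by rewrite !mul0r add0r subr0 expr0 mul1r mulrC expr2.
  by rewrite /= !exprS; ring.
- rewrite {2 3}/flat ltxx mulr0 subr0.
  suff h : (fun h : R => h^-1 *: (flat n (h *: 1 + 0) - flat n 0)) @ 0^' --> (0 : R).
    apply: DeriveDef; first by apply/cvg_ex; exists 0.
    by apply/cvg_lim.
  apply/cvgrPdist_le => e e0; near=> h.
  rewrite sub0r normrN addr0 /GRing.scale/= mulr1 {2}/flat ltxx subr0.
  have h0 : h != 0 by near: h; exact: nbhs_dnbhs_neq.
  have he : `|h| <= e / n.+2`!%:R.
    near: h; apply: dnbhs0_le; rewrite divr_gt0// ltr0n fact_gt0//.
  have -> : h^-1 * flat n h = flat n.+1 h.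
    by rewrite /flat; case: ifPn => hp; rewrite ?mulr0// mulrA -invfM -exprS.
  rewrite ger0_norm ?flat_ge0//.
  have [hp|hp] := ltP 0 h; last by rewrite /flat ltNge hp ltW.
  apply: (le_trans (flat_le _ (ltW hp))).
  rewrite -(gtr0_norm hp).
  by rewrite mulrC -ler_pdivlMr// ltr0n fact_gt0.
Unshelve. all: by end_near. Qed.

Lemma diffn_flat k n : diffn k (flat n).
Proof.
elim: k n => [|k IH] n; first exact: diffn0 (flat_derive n).
apply: diffnS (flat_derive n) _.
have := diffnD (IH n.+2) (diffnM (diffn_cst k (- n%:R)) (IH n.+1)).
by under eq_fun do rewrite /= mulNr.
Qed.

(** A smooth step: 0 on the negative half-line, 1 from 1 on. *)
Definition sstep (x : R) : R := flat 0 x / (flat 0 x + flat 0 (1 - x)).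

Lemma flat_gt0 n (x : R) : 0 < x -> 0 < flat n x.
Proof. by move=> x0; rewrite /flat x0 mulr_gt0 ?expR_gt0// invr_gt0 exprn_gt0. Qed.

Lemma sstep_den_gt0 (x : R) : 0 < flat 0 x + flat 0 (1 - x).
Proof.
have [x0|x0] := ltP 0 x; first by rewrite ltr_pwDl ?flat_gt0 ?flat_ge0.
by rewrite ltr_wpDl ?flat_ge0// flat_gt0//; lra.
Qed.

Lemma diffn_sstep n : diffn n sstep.
Proof.
apply: diffnM; first exact: diffn_flat.
apply: diffnV; first by move=> t; rewrite gt_eqF ?sstep_den_gt0.
apply: diffnD; first exact: diffn_flat.
have := diffn_affine (-1) 1 (diffn_flat n 0).
by under eq_fun do rewrite mulN1r addrC.
Qed.

Lemma sstep_le0 (x : R) : x <= 0 -> sstep x = 0.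
Proof. by move=> x0; rewrite /sstep /flat ltNge x0 mul0r. Qed.

Lemma sstep_ge1 (x : R) : 1 <= x -> sstep x = 1.
Proof.
move=> x1; have := sstep_den_gt0 x; rewrite /sstep.
have -> : flat 0 (1 - x) = 0 by rewrite /flat ltNge; have -> : 1 - x <= 0 by lra.
by rewrite addr0 => /lt0r_neq0 h; rewrite mulfV.
Qed.

Lemma sstep_ge0 (x : R) : 0 <= sstep x.
Proof. by rewrite divr_ge0 ?flat_ge0// ltW// sstep_den_gt0. Qed.

Lemma sstep_le1 (x : R) : sstep x <= 1.
Proof. by rewrite ler_pdivrMr ?sstep_den_gt0// mul1r lerDl flat_ge0. Qed.

Lemma smooth_derive f (t : R) : smooth f -> is_derive t 1 f (derive1 f t).
Proof. by move=> sf; rewrite derive1E; apply: derivableP; exact: (sf 0). Qed.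

Lemma smooth_derive1 f : smooth f -> smooth (derive1 f).
Proof. by move=> sf n t; rewrite -derive1Sn; exact: sf. Qed.

Lemma smooth_continuous f : smooth f -> continuous f.
Proof.
by move=> sf t; apply: differentiable_continuous; apply/derivable1_diffP; exact: (sf 0).
Qed.

Lemma smooth_sstep : smooth sstep.
Proof. by apply/smooth_diffn => n; exact: diffn_sstep. Qed.

Lemma smooth_cst (c : R) : smooth (cst c).
Proof. by apply/smooth_diffn => n; exact: diffn_cst. Qed.

Lemma smoothD f g : smooth f -> smooth g -> smooth (fun x => f x + g x).
Proof. by move=> /smooth_diffn sf /smooth_diffn sg; apply/smooth_diffn => n; exact: diffnD. Qed.

Lemma smoothM f g : smooth f -> smooth g -> smooth (fun x => f x * g x).
Proof. by move=> /smooth_diffn sf /smooth_diffn sg; apply/smooth_diffn => n; exact: diffnM. Qed.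

Lemma smooth_affine f (a c : R) : smooth f -> smooth (fun x => f (a * x + c)).
Proof. by move=> /smooth_diffn sf; apply/smooth_diffn => n; exact: diffn_affine. Qed.

Lemma smooth_antiderivative f f' : (forall t : R, is_derive t 1 f (f' t)) ->
  smooth f' -> smooth f.
Proof.
move=> df /smooth_diffn sf; apply/smooth_diffn => -[|n]; first exact: diffn0 df.
exact: diffnS df (sf n).
Qed.

Lemma derive1_near_cst f (t c : R) : (\forall x \near t, f x = c) -> derive1 f t = 0.
Proof.
move=> fc; rewrite derive1E; have <- : 'D_1 (cst c) t = 0 :> R by exact: derive_cst.
exact: near_eq_derive.
Qed.

Lemma sstep_derive_lt0 (x : R) : x < 0 -> derive1 sstep x = 0.
Proof.
move=> x0; apply: (@derive1_near_cst _ _ 0); near=> y.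
by rewrite sstep_le0// ltW//; near: y; exact: lt_nbhsl.
Unshelve. all: by end_near. Qed.

Lemma sstep_derive_gt1 (x : R) : 1 < x -> derive1 sstep x = 0.
Proof.
move=> x1; apply: (@derive1_near_cst _ _ 1); near=> y.
by rewrite sstep_ge1// ltW//; near: y; exact: lt_nbhsr.
Unshelve. all: by end_near. Qed.

(** The derivative is continuous and vanishes outside a compact interval. *)
Lemma sstep_derive_bounded : exists2 K : R, 0 < K & forall x, `|derive1 sstep x| <= K.
Proof.
have ct : continuous (derive1 sstep) by exact/smooth_continuous/smooth_derive1/smooth_sstep.
have /compact_bounded[M [_ bM]] : compact (derive1 sstep @` `[0, 1]).
  apply: continuous_compact; last exact: segment_compact.
  exact: continuous_subspaceT.
pose K := `|M| + 1.
have K0 : 0 < K by rewrite ltr_wpDl.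
exists K => // x.
have MK : M < K by rewrite (le_lt_trans (ler_norm _))// ltrDl.
have [x0|x0] := ltP x 0; first by rewrite sstep_derive_lt0// normr0 ltW.
have [x1|x1] := ltP 1 x; first by rewrite sstep_derive_gt1// normr0 ltW.
by apply: (bM K MK); exists x => //=; rewrite in_itv/= x0.
Qed.
End SmoothFunctions.

(** * Test functions on the half-line *)

Section TestFunctions.
Context {R : realType}.
Notation mu := (@lebesgue_measure R).
Implicit Types (f g u : R -> R) (a b s t x : R).

Lemma open_Rpos : open (Rpos R). Proof. exact: interval_open. Qed.
Lemma measurable_Rpos : measurable (Rpos R). Proof. exact: measurable_itv. Qed.
Lemma RposP t : Rpos R t <-> 0 < t.
Proof. by rewrite /Rpos/= in_itv/= ?andbT. Qed.
Lemma sub_itv_Rpos a b : 0 < a -> `[a, b] `<=` Rpos R.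
Proof. by move=> a0 t /=; rewrite in_itv/= => /andP[h _]; apply/RposP; exact: lt_le_trans h. Qed.

(** A concrete substitute for compact support, equivalent to it for smooth
    functions when [0 < a] ([smooth_C0infty] and [C0infty_smooth]). *)
Definition supp_in f a b := forall t, f t != 0 -> a <= t <= b.

Lemma closure_support f a b : supp_in f a b -> closure [set t | f t != 0] `<=` `[a, b].
Proof.
move=> fs; have /closure_id -> : closed `[a, b] by exact: interval_closed.
by apply: closure_subset => t /= /fs; rewrite in_itv.
Qed.

Lemma smooth_C0infty f a b : 0 < a -> smooth f -> supp_in f a b -> C0infty f.
Proof.
move=> a0 sf /closure_support cs; split=> //.
  by apply: (subclosed_compact _ (@segment_compact _ a b) cs); exact: closed_closure.
by apply: subset_trans cs _; exact: sub_itv_Rpos.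
Qed.

Lemma C0infty_smooth f : C0infty f ->
  smooth f /\ exists a b, [/\ 0 < a, a < b & supp_in f a b].
Proof.
move=> [sf cpt sub]; split=> //.
set S := closure _ in cpt sub.
have [M [_ HM]] := compact_bounded cpt.
have n0 : ~ S 0 by move=> /sub /RposP; rewrite ltxx.
have : nbhs (0 : R) (~` S).
  by apply: open_nbhs_nbhs; split=> //; apply: closed_openC; exact: closed_closure.
move=> /nbhs_ballP[e /= e0 eS].
exists e, (Num.max e (`|M| + 1) + 1); split=> //.
  by rewrite (le_lt_trans (_ : e <= Num.max e (`|M| + 1)))// ?le_max ?lexx// ltrDl.
move=> t ft; have St : S t by apply: subset_closure.
have t0 : 0 < t by apply/RposP/sub.
apply/andP; split.
  rewrite leNgt; apply/negP => te; apply: (eS t) => //.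
  by rewrite /ball/= sub0r normrN gtr0_norm.
have MM : M < `|M| + 1 by rewrite (le_lt_trans (ler_norm _))// ltrDl.
have := HM _ MM _ St; rewrite /= gtr0_norm// => h.
by rewrite (le_trans h)// (@le_trans _ _ (Num.max e (`|M| + 1)))// ?le_max ?lexx ?orbT// lerDl.
Qed.

Lemma supp_in_derive1 f a b : supp_in f a b -> supp_in (derive1 f) a b.
Proof.
move=> fs t; apply: contraR; rewrite negb_and -!ltNge => ht.
have H y : (y < a) || (b < y) -> f y = 0.
  move=> hy; apply/eqP; apply: contraTT hy => /fs.
  by rewrite negb_or -!leNgt.
apply/eqP; apply: (@derive1_near_cst _ _ _ 0); case/orP: ht => ht; near=> y; apply: H; apply/orP.
  by left; near: y; exact: lt_nbhsl.
by right; near: y; exact: lt_nbhsr.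
Unshelve. all: by end_near. Qed.

Lemma C0inftyM f g : smooth f -> C0infty g -> C0infty (fun x => f x * g x).
Proof.
move=> sf /C0infty_smooth[sg [a [b [a0 ab fs]]]].
apply: smooth_C0infty a0 (smoothM sf sg) (_ : supp_in _ a b).
by move=> t; rewrite mulf_eq0 negb_or => /andP[_ /fs].
Qed.

Lemma locally_integrable_measurable g a b : locally_integrable (Rpos R) g -> 0 < a ->
  measurable_fun `[a, b] g.
Proof.
move=> [mg _ _] a0; apply: measurable_funS mg; [exact: measurable_Rpos|exact: sub_itv_Rpos].
Qed.

Lemma locally_integrable_itv g a b : locally_integrable (Rpos R) g -> 0 < a ->
  mu.-integrable `[a, b] (EFin \o g).
Proof.
move=> lg a0; have [_ _ ig] := lg; apply/integrableP; split.
  by apply/measurable_EFinP; exact: locally_integrable_measurable.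
apply: ig; first exact: sub_itv_Rpos.
exact: segment_compact.
Qed.

Lemma continuous_itv_bounded f a b : continuous f -> [bounded f x | x in `[a, b]].
Proof.
move=> cf; have /compact_bounded[M [Mr HM]] : compact (f @` `[a, b]).
  by apply: continuous_compact; [exact: continuous_subspaceT|exact: segment_compact].
by exists M; split=> // x Mx y yab; apply: (HM x Mx); exists y.
Qed.

Lemma continuous_measurable f (D : set R) : continuous f -> measurable_fun D f.
Proof.
move=> cf; apply: (@measurable_funS _ _ _ _ setT) => //.
exact: continuous_measurable_fun.
Qed.

Lemma supp_in_patch f a b : supp_in f a b -> f \_ `[a, b] = f.
Proof.
move=> fs; apply/funext => t; rewrite patchE; case: ifPn => // tn.
apply/esym/eqP; apply: contraNT tn => /fs h; rewrite inE/=; by rewrite in_itv.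
Qed.

Lemma supp_in_integrable g f a b : locally_integrable (Rpos R) g -> continuous f ->
  0 < a -> supp_in f a b -> mu.-integrable (Rpos R) (EFin \o (fun t => g t * f t)).
Proof.
move=> lg cf a0 fs.
have i1 : mu.-integrable `[a, b] (EFin \o (fun t => g t * f t)).
  have -> : EFin \o (fun t => g t * f t) = ((EFin \o g) \* (EFin \o f))%E.
    by apply/funext => t /=; rewrite EFinM.
  apply: integrableMl => //; first exact: locally_integrable_itv.
    exact: continuous_measurable.
  exact: continuous_itv_bounded.
move: i1; rewrite integrable_mkcond//= restrict_EFin.
rewrite (@supp_in_patch _ a b); last by move=> t; rewrite mulf_eq0 negb_or => /andP[_ /fs].
move=> i2; apply: integrableS i2 => //; exact: measurable_Rpos.
Qed.

Lemma supp_in_Rintegral f a b : 0 < a -> supp_in f a b ->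
  \int[mu]_(t in Rpos R) f t = \int[mu]_(t in `[a, b]) f t.
Proof.
move=> a0 fs; rewrite -(setIidr (@sub_itv_Rpos a b a0)) Rintegral_mkcondr.
by rewrite (supp_in_patch fs).
Qed.

Lemma smooth_FTC2 f a b : a < b -> smooth f ->
  \int[mu]_(t in `[a, b]) derive1 f t = f b - f a.
Proof.
move=> ab sf; rewrite /Rintegral.
rewrite (@continuous_FTC2 R (derive1 f) f a b ab).
- by [].
- exact/continuous_subspaceT/smooth_continuous/smooth_derive1.
- split.
  + by move=> x _; exact: (sf 0).
  + by apply: cvg_at_right_filter; exact: smooth_continuous.
  + by apply: cvg_at_left_filter; exact: smooth_continuous.
- by [].
Qed.

Lemma Rintegral_C0infty_derive1 f : C0infty f ->
  \int[mu]_(t in Rpos R) derive1 f t = 0.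
Proof.
move=> /C0infty_smooth[sf [a [b [a0 ab fs]]]].
have fs' : supp_in f (a / 2) (b + 1).
  move=> t /fs /andP[h1 h2]; apply/andP; split; lra.
rewrite (@supp_in_Rintegral _ (a / 2) (b + 1)); [|lra|exact: supp_in_derive1].
rewrite smooth_FTC2//; last lra.
have z t : ~~ (a <= t <= b) -> f t = 0 by move=> h; apply/eqP; apply: contraNT h => /fs.
by rewrite !z ?subr0//; apply/negP => /andP[]; lra.
Qed.

Lemma continuous_locally_integrable f : continuous f -> locally_integrable (Rpos R) f.
Proof.
move=> cf; split; [exact: continuous_measurable|exact: open_Rpos|].
move=> K _ cK.
have /integrableP[_] := continuous_compact_integrable cK (continuous_subspaceT cf).
by [].
Qed.

(** Integration by parts: [f * phi] is a test function, and the derivative of a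
    test function has integral 0 by the fundamental theorem. *)
Lemma weak_derive_smooth f : smooth f -> is_weak_derive f (derive1 f).
Proof.
move=> sf; split; first exact/continuous_locally_integrable/smooth_continuous/smooth_derive1.
move=> phi cphi; have [sp [a [b [a0 ab ps]]]] := C0infty_smooth cphi.
have := Rintegral_C0infty_derive1 (C0inftyM sf cphi).
have -> : derive1 (fun x => f x * phi x) = (fun t => f t * derive1 phi t + derive1 f t * phi t).
  apply: derive1_is_derive => t; rewrite addrC.
  by apply: is_derive_mulf; exact: smooth_derive.
rewrite RintegralD; first by move=> /eqP; rewrite addr_eq0 => /eqP.
- exact: measurable_Rpos.
- apply: (@supp_in_integrable _ _ a b) => //.
  + exact/continuous_locally_integrable/smooth_continuous.
  + exact/smooth_continuous/smooth_derive1.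
  + exact: supp_in_derive1.
- apply: (@supp_in_integrable _ _ a b) => //.
  + exact/continuous_locally_integrable/smooth_continuous/smooth_derive1.
  + exact/smooth_continuous.
Qed.

Lemma weak_deriveB u g v h : locally_integrable (Rpos R) u -> locally_integrable (Rpos R) v ->
  is_weak_derive u g -> is_weak_derive v h ->
  is_weak_derive (u \- v) (g \- h).
Proof.
move=> lu lv [lg ug] [lh vh]; split; first exact: locally_integrableB.
move=> phi cphi; have [sp [a [b [a0 ab ps]]]] := C0infty_smooth cphi.
under eq_Rintegral do rewrite mulrBl.
under [in RHS]eq_Rintegral do rewrite mulrBl.
have mR := measurable_Rpos.
have cp := smooth_continuous sp.
have cp' := smooth_continuous (smooth_derive1 sp).
have ps' := supp_in_derive1 ps.
rewrite !RintegralB//; [|exact: (@supp_in_integrable _ _ a b)..].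
by rewrite (ug _ cphi) (vh _ cphi) opprB opprK addrC.
Qed.

End TestFunctions.

(** * The fundamental theorem for weak derivatives *)

Section WeakFTC.
Context {R : realType}.
Notation mu := (@lebesgue_measure R).
Implicit Types (f g u h : R -> R) (a b s t x : R).

Lemma Rdominated_cvg (D : set R) (f_ : nat -> R -> R) f h :
  measurable D -> (forall n, measurable_fun D (f_ n)) ->
  (forall x, D x -> f_ n x @[n --> \oo] --> f x) ->
  mu.-integrable D (EFin \o h) ->
  (forall n x, D x -> `|f_ n x| <= h x) ->
  \int[mu]_(x in D) f_ n x @[n --> \oo] --> \int[mu]_(x in D) f x.
Proof.
move=> mD mf ff ih fh.
have mlim : measurable_fun D f by exact: measurable_fun_cvg mf ff.
have [i1 _ c] : [/\ mu.-integrable D (EFin \o f),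
   (\int[mu]_(x in D) `|(f_ n x)%:E - (f x)%:E|)%E @[n --> \oo] --> (0 : \bar R)%E &
   (\int[mu]_(x in D) (f_ n x)%:E)%E @[n --> \oo] --> (\int[mu]_(x in D) (f x)%:E)%E].
  apply: (@dominated_convergence _ _ _ mu D mD (fun n => EFin \o f_ n) (EFin \o f) (EFin \o h)) => //.
  - by move=> n; apply/measurable_EFinP; exact: mf.
  - by apply/measurable_EFinP; exact: mlim.
  - by apply/aeW => x Dx; apply: cvg_EFin; [by apply: nearW => n|exact: ff].
  - by apply/aeW => x n Dx /=; rewrite lee_fin; exact: fh.
rewrite /Rintegral; apply: fine_cvg; rewrite fineK//.
exact: integrable_fin_num.
Qed.

(** As [n] grows these smooth functions tend to the indicator of [`]s, +oo[],
    and their derivatives concentrate at [s]. *)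
Definition ramp s (n : nat) x : R := sstep (n.+1%:R * x + - (n.+1%:R * s)).

Lemma smooth_ramp s n : smooth (ramp s n).
Proof. exact/smooth_affine/smooth_sstep. Qed.

Lemma ramp_le s n x : x <= s -> ramp s n x = 0.
Proof. by move=> xs; rewrite /ramp sstep_le0// subr_le0 ler_pM2l. Qed.

Lemma ramp_ge s n x : s + n.+1%:R^-1 <= x -> ramp s n x = 1.
Proof.
move=> xs; rewrite /ramp sstep_ge1// -mulrBr mulrC -ler_pdivrMr// mul1r.
by rewrite lerBrDl.
Qed.

Lemma is_derive_ramp s n x :
  is_derive x 1 (ramp s n) (derive1 sstep (n.+1%:R * x + - (n.+1%:R * s)) * n.+1%:R).
Proof.
apply: (@is_derive1_comp _ sstep); last exact: is_derive_affine.
exact/smooth_derive/smooth_sstep.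
Qed.

Lemma derive1_ramp s n x :
  derive1 (ramp s n) x = derive1 sstep (n.+1%:R * x + - (n.+1%:R * s)) * n.+1%:R.
Proof. by have [_ <-] := is_derive_ramp s n x; rewrite derive1E. Qed.

Lemma ramp_derive_bounded : exists2 K : R, 0 < K & forall s n x,
  `|derive1 (ramp s n) x| <= K * n.+1%:R.
Proof.
have [K K0 HK] := @sstep_derive_bounded R; exists K => // s n x.
rewrite derive1_ramp.
by rewrite normrM ler_pM// ger0_norm.
Qed.

Lemma supp_in_derive_ramp s n : supp_in (derive1 (ramp s n)) s (s + n.+1%:R^-1).
Proof.
move=> x; rewrite derive1_ramp.
apply: contraR; rewrite negb_and -!ltNge => /orP[h|h]; apply/eqP.
  by rewrite sstep_derive_lt0 ?mul0r// subr_lt0 ltr_pM2l.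
by rewrite sstep_derive_gt1 ?mul0r// -mulrBr mulrC -ltr_pdivrMr// mul1r ltrBrDl.
Qed.

(** The derivatives of the ramps form an approximate identity at [s]: they have
    integral 1 on an interval of length [n.+1%:R^-1], and they are at most
    [K * n.+1%:R] there. *)
Lemma Rintegral_ramp_cvg u s : locally_integrable (Rpos R) u -> 0 < s ->
  {for s, continuous u} ->
  \int[mu]_(x in Rpos R) (u x * derive1 (ramp s n) x) @[n --> \oo] --> u s.
Proof.
move=> lu s0 us; have [K K0 HK] := ramp_derive_bounded.
apply/cvgrPdist_le => e e0.
have eK : 0 < e / K by rewrite divr_gt0.
have : u x @[x --> s] --> u s by exact: us.
move=> /cvgrPdist_le/(_ _ eK)/nbhs_ballP[d /= d0 Hd].
near=> n.
set b := s + n.+1%:R^-1.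
have sb : s < b by rewrite /b ltrDl.
have bd : b - s < d by rewrite /b addrC addKr; near: n; exact: (near_infty_natSinv_lt (PosNum d0)).
pose r := derive1 (ramp s n).
have cr : continuous r by exact/smooth_continuous/smooth_derive1/smooth_ramp.
have rs := @supp_in_derive_ramp s n.
have r1 : \int[mu]_(x in `[s, b]) r x = 1.
  by rewrite (smooth_FTC2 sb (@smooth_ramp s n)) (@ramp_le s n s)// (@ramp_ge s n b)// subr0.
have iur : mu.-integrable `[s, b] (EFin \o (fun x => u x * r x)).
  have := supp_in_integrable lu cr s0 rs.
  by apply: integrableS; [exact: measurable_Rpos| |exact: sub_itv_Rpos].
have ir : mu.-integrable `[s, b] (EFin \o r).
  by apply: continuous_compact_integrable; [exact: segment_compact|exact: continuous_subspaceT].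
have iusr : mu.-integrable `[s, b] (EFin \o (fun x => u s * r x)).
  exact: (integrableZl _ _ ir).
rewrite (@supp_in_Rintegral _ _ s b)//; last first.
  by move=> x; rewrite mulf_eq0 negb_or => /andP[_]; exact: rs.
rewrite -[X in X - _]mulr1 -r1 -RintegralZl// -RintegralB//.
have -> : (fun x => u s * r x - u x * r x) = (fun x => (u s - u x) * r x).
  by apply/funext => x; rewrite mulrBl.
have iD : mu.-integrable `[s, b] (EFin \o (fun x => (u s - u x) * r x)).
  have := integrableB _ iusr iur => /(_ (measurable_itv _)).
  apply: eq_integrable => //= x _ /=; by rewrite mulrBl EFinB.
apply: (le_trans (le_normr_Rintegral _ iD)) => //.
apply: (@le_trans _ _ (\int[mu]_(x in `[s, b]) cst (e / K * (K * n.+1%:R)) x)).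
  apply: le_Rintegral => //.
  - exact: integrable_norm.
  - apply: continuous_compact_integrable; [exact: segment_compact|].
    by apply: continuous_subspaceT => x; exact: cvg_cst.
  - move=> x /=; rewrite in_itv/= => /andP[sx xb].
    rewrite normrM ler_pM//; last exact: HK.
    apply: Hd; rewrite /ball/= distrC ger0_norm ?subr_ge0//.
    by rewrite (le_lt_trans _ bd)// lerB.
rewrite Rintegral_cst//= lebesgue_measure_itv/= lte_fin sb/=.
rewrite /b addrC addKr.
have Kn : K != 0 by rewrite gt_eqF.
by rewrite mulrA divfK// mulfK// pnatr_eq0.
Unshelve. all: by end_near. Qed.

(** The difference of the ramps at [s] and at [t] is a test function tending to
    the indicator of [`]s, t]].  In the weak formulation the integral of [u]
    against its derivative tends to [u s - u t], and the integral of [g] against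
    it tends to that of [g] over [`]s, t]] by dominated convergence. *)
Lemma weak_derive_FTC u g s t : locally_integrable (Rpos R) u ->
  (forall x, Rpos R x -> {for x, continuous u}) ->
  is_weak_derive u g -> 0 < s -> s <= t ->
  \int[mu]_(x in `]s, t]) g x = u t - u s.
Proof.
move=> lu cu [lg ug] s0.
rewrite le_eqVlt => /predU1P[<-|st]; first by rewrite set_itvoc0 Rintegral_set0 subrr.
have t0 : 0 < t by exact: lt_trans st.
pose phi n x := ramp s n x + (-1) * ramp t n x.
have sp n : smooth (phi n).
  apply: smoothD; first exact: smooth_ramp.
  by apply: smoothM; [exact: smooth_cst|exact: smooth_ramp].
have n1 n : n.+1%:R^-1 <= 1 :> R by rewrite invf_le1// ler1n.
have ps n : supp_in (phi n) s (t + 1).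
  move=> x; apply: contraR; rewrite negb_and -!ltNge => /orP[h|h]; apply/eqP; rewrite /phi.
    by rewrite !ramp_le ?mulr0 ?addr0// ltW// (lt_trans h).
  have [sx tx] : s + n.+1%:R^-1 <= x /\ t + n.+1%:R^-1 <= x.
    by move: (n1 n); set q := _^-1 => q1; split; lra.
  by rewrite !ramp_ge// mulr1 subrr.
have cp n : C0infty (phi n) by exact: smooth_C0infty s0 (sp n) (ps n).
have mR := @measurable_Rpos R.
have L : \int[mu]_(x in Rpos R) (u x * derive1 (phi n) x) @[n --> \oo] --> u s - u t.
  have -> : (fun n => \int[mu]_(x in Rpos R) (u x * derive1 (phi n) x)) =
     (fun n => \int[mu]_(x in Rpos R) (u x * derive1 (ramp s n) x) -
       \int[mu]_(x in Rpos R) (u x * derive1 (ramp t n) x)).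
    apply/funext => n; rewrite -RintegralB//.
    + apply: eq_Rintegral => x _; rewrite -mulrBr; congr (_ * _).
      have -> : derive1 (phi n) = fun x => derive1 (ramp s n) x +
          (0 * ramp t n x + (-1) * derive1 (ramp t n) x).
        apply: derive1_is_derive => y; apply: is_derive_addf; first exact/smooth_derive/smooth_ramp.
        have dc : is_derive y 1 (cst (-1) : R -> R) 0 by exact: is_derive_cst.
        exact: is_derive_mulf dc (smooth_derive y (@smooth_ramp t n)).
      by rewrite mul0r add0r mulN1r.
    + apply: (supp_in_integrable lu _ s0 (@supp_in_derive_ramp s n)).
      exact/smooth_continuous/smooth_derive1/smooth_ramp.
    + apply: (supp_in_integrable lu _ t0 (@supp_in_derive_ramp t n)).
      exact/smooth_continuous/smooth_derive1/smooth_ramp.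
  by apply: cvgB; apply: Rintegral_ramp_cvg => //; apply: cu; apply/RposP.
have Rg : \int[mu]_(x in Rpos R) (g x * phi n x) @[n --> \oo] -->
    \int[mu]_(x in Rpos R) (g \_ `]s, t]) x.
  apply: (@Rdominated_cvg _ _ _ ((Num.norm \o g) \_ `[s, t + 1])) => //.
  - move=> n; apply: measurable_funM; first by case: lg.
    apply: continuous_measurable; apply: smooth_continuous; exact: sp.
  - move=> x _; rewrite patchE; case: ifPn => [|]; rewrite ?inE/= ?notin_setE/= in_itv/=.
      move=> /andP[sx xt]; apply: cvg_near_cst; near=> n.
      rewrite /phi (@ramp_le t)// mulr0 addr0 ramp_ge ?mulr1//.
      rewrite -lerBrDl ltW//; near: n.
      by apply: (near_infty_natSinv_lt (PosNum _)); rewrite subr_gt0.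
    move=> /negP; rewrite negb_and -leNgt -ltNge => /orP[xs|tx].
      by apply: cvg_near_cst; near=> n; rewrite /phi !ramp_le ?mulr0 ?addr0 ?mulr0// (le_trans xs)// ltW.
    apply: cvg_near_cst; near=> n.
    have tn : t + n.+1%:R^-1 <= x.
      rewrite -lerBrDl ltW//; near: n.
      by apply: (near_infty_natSinv_lt (PosNum _)); rewrite subr_gt0.
    have sn : s + n.+1%:R^-1 <= x by rewrite (le_trans _ tn)// lerD2r ltW.
    by rewrite /phi !ramp_ge// mulr1 subrr mulr0.
  - rewrite -restrict_EFin; apply/integrable_restrict => //.
    rewrite setIidr; last exact: sub_itv_Rpos.
    by apply: integrable_norm; exact: locally_integrable_itv.
  - move=> n x _; rewrite patchE; case: ifPn => [|]; rewrite ?inE/= ?notin_setE/= in_itv/= => h.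
      rewrite normrM ler_piMr// /phi /ramp.
      have := @sstep_ge0 R (n.+1%:R * x - n.+1%:R * s).
      have := @sstep_le1 R (n.+1%:R * x - n.+1%:R * s).
      have := @sstep_ge0 R (n.+1%:R * x - n.+1%:R * t).
      have := @sstep_le1 R (n.+1%:R * x - n.+1%:R * t).
      move=> *; rewrite ler_norml; apply/andP; split; lra.
    have -> : phi n x = 0 by apply/eqP; apply: contra_notT h => /ps.
    by rewrite mulr0 normr0.
have E n : \int[mu]_(x in Rpos R) (u x * derive1 (phi n) x) =
    - \int[mu]_(x in Rpos R) (g x * phi n x) by exact: ug.
have : u s - u t = - \int[mu]_(x in Rpos R) (g \_ `]s, t]) x.
  have L2 : \int[mu]_(x in Rpos R) (u x * derive1 (phi n) x) @[n --> \oo] -->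
      - \int[mu]_(x in Rpos R) (g \_ `]s, t]) x.
    by rewrite (funext E); exact: cvgN.
  exact: (cvg_unique _ L L2).
rewrite -Rintegral_mkcondr setIidr; last first.
  by apply: subset_trans (@sub_itv_Rpos _ s t s0); exact: subset_itv_oc_cc.
by move=> h; rewrite -[LHS]opprK -h opprB.
Unshelve. all: by end_near. Qed.

End WeakFTC.

Section WeakDeriveUnique.
Context {R : realType}.
Notation mu := (@lebesgue_measure R).
Implicit Types (f g u h : R -> R) (a b s t x : R).

(** The indefinite integral vanishes identically, and by Lebesgue
    differentiation its derivative is [g] almost everywhere. *)
Lemma ae_eq0_of_Rintegral0 g a b : mu.-integrable `]a, b] (EFin \o g) ->
  (forall x, a <= x <= b -> \int[mu]_(y in `]a, x]) g y = 0) ->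
  {ae mu, forall x, `]a, b]%classic x -> g x = 0}.
Proof.
move=> ig g0; pose f := g \_ `]a, b].
have iT : mu.-integrable setT (EFin \o f).
  by move: ig; rewrite integrable_mkcond//= restrict_EFin.
have F0 x : \int[mu]_(y in `]-oo, x]) f y = 0.
  rewrite -Rintegral_mkcondr.
  have -> : `]-oo, x] `&` `]a, b] = `]a, Num.min x b]%classic.
    apply/seteqP; split=> y /=; rewrite !in_itv/= le_min.
      by move=> [-> /andP[-> ->]].
    by move=> /and3P[-> -> ->].
  have [ab|ab] := leP a (Num.min x b); first by rewrite g0// ab ge_min lexx orbT.
  by rewrite set_itv_ge ?Rintegral_set0// bnd_simp -leNgt ltW.
have := @FTC1Ny R f.
have i2 y : mu.-integrable `]-oo, y] (EFin \o f).
  exact: integrableS iT.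
have l2 : locally_integrable setT f.
  by apply: open_integrable_locally => //; exact: openT.
move=> /(_ i2 l2); apply: filterS; first exact: (ae_filter_ringOfSetsType mu).
move=> x [_ +] xab.
have -> : (fun y : R => \int[mu]_(t in [set` `]-oo, y]]) f t) = cst 0.
  by apply/funext => y; exact: F0.
by rewrite derive1_cst /f patchE mem_set.
Qed.

Lemma weak_derive_unique u g1 g2 : locally_integrable (Rpos R) u ->
  (forall x, Rpos R x -> {for x, continuous u}) ->
  is_weak_derive u g1 -> is_weak_derive u g2 ->
  {ae mu, forall x, Rpos R x -> g1 x = g2 x}.
Proof.
move=> lu cu w1 w2; have [lg1 _] := w1; have [lg2 _] := w2.
pose A n := `]n.+1%:R^-1, n.+1%:R : R]%classic.
have n0 n : 0 < n.+1%:R^-1 :> R by rewrite invr_gt0.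
have ioc g (s t : R) : locally_integrable (Rpos R) g -> 0 < s ->
    mu.-integrable `]s, t] (EFin \o g).
  move=> lg s0; have := locally_integrable_itv t lg s0.
  apply: integrableS => //; exact: subset_itv_oc_cc.
have H n : {ae mu, forall x, A n x -> g1 x - g2 x = 0}.
  apply: (@ae_eq0_of_Rintegral0 (fun x => g1 x - g2 x)).
    by apply: (integrableB _ (ioc _ _ _ lg1 _) (ioc _ _ _ lg2 _)).
  move=> x /andP[nx xn]; rewrite RintegralB//; [|exact: ioc..].
  by rewrite !(weak_derive_FTC lu cu _ (n0 n) nx) ?subrr.
have : {ae mu, forall x n, A n x -> g1 x - g2 x = 0}.
  exact: ae_foralln.
apply: filterS; first exact: (ae_filter_ringOfSetsType mu).
move=> x Hx /RposP x0; apply/eqP; rewrite -subr_eq0; apply/eqP.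
have [n [h1 h2]] : exists n : nat, n.+1%:R^-1 < x /\ x <= n.+1%:R.
  near \oo => n; exists n; split; near: n; first exact: (near_infty_natSinv_lt (PosNum x0)).
  exists (Num.truncn x).+1 => // n /= hn.
  rewrite (le_trans (ltW (truncnS_gt x)))// ler_nat; exact: leqW.
by apply: (Hx n); rewrite /A/= in_itv/= h1.
Unshelve. all: by end_near. Qed.
End WeakDeriveUnique.

(** * Power inequalities and integral estimates *)

Section Powers.
Context {R : realType}.
Implicit Types (x y p k : R).

Lemma powR_inv x p : 0 <= x -> x^-1 `^ p = (x `^ p)^-1.
Proof. by move=> x0; rewrite -powR_inv1// -powRrM mulN1r powRN. Qed.

Lemma le_powR_cancel x y p : 0 < p -> 0 <= x -> 0 <= y -> x `^ p <= y `^ p -> x <= y.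
Proof.
move=> p0 x0 y0; apply: contraTT; rewrite -!ltNge => yx.
by apply: gt0_ltr_powR.
Qed.

(** A weak form of Young's inequality: the first term suffices if [x <= eta],
    the second one otherwise.  With [eta] optimized it replaces the Hoelder
    inequality, at the cost of a factor [2 `^ p]. *)
Lemma powR_le_young x eta p : 0 <= x -> 0 < eta -> 1 <= p ->
  x <= eta + eta `^ (1 - p) * x `^ p.
Proof.
move=> x0 e0 p1; have [xe|ex] := leP x eta.
  by rewrite (le_trans xe)// lerDl mulr_ge0 ?powR_ge0.
rewrite (@le_trans _ _ (eta `^ (1 - p) * x `^ p))//; last by rewrite lerDr ltW.
have -> : eta `^ (1 - p) * x `^ p = eta * (x / eta) `^ p.
  rewrite powRM ?invr_ge0 ?(ltW e0)// powR_inv ?(ltW e0)// powRB; last first.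
    by rewrite (gt_eqF e0) implybT.
  by rewrite powRr1 ?(ltW e0)// mulrAC mulrA.
have : x / eta <= (x / eta) `^ p.
  by apply: le1r_powR => //; rewrite ler_pdivlMr// mul1r ltW.
by rewrite ler_pdivrMr// mulrC.
Qed.

Lemma powRD_le x y p : 0 <= x -> 0 <= y -> 0 <= p ->
  (x + y) `^ p <= 2 `^ p * (x `^ p + y `^ p).
Proof.
move=> x0 y0 p0; wlog xy : x y x0 y0 / x <= y.
  move=> H; have [xy|/ltW yx] := leP x y; first exact: H.
  by rewrite addrC [x `^ p + _]addrC H.
apply: (@le_trans _ _ ((2 * y) `^ p)).
  by apply: ge0_ler_powR => //; rewrite ?nnegrE ?addr_ge0 ?mulr_ge0//; lra.
by rewrite powRM// ler_wpM2l ?powR_ge0// lerDr powR_ge0.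
Qed.

(** Convexity of [powR ^~ p] at the points [x / k] and [y / (1 - k)] with weights
    [k] and [1 - k]. *)
Lemma powRD_convex x y p k : 0 <= x -> 0 <= y -> 1 <= p -> 0 < k -> k < 1 ->
  (x + y) `^ p <= k `^ (1 - p) * x `^ p + (1 - k) `^ (1 - p) * y `^ p.
Proof.
move=> x0 y0 p1 k0 k1.
have k1' : 0 < 1 - k by rewrite subr_gt0.
have E z l : 0 <= z -> 0 < l -> l `^ (1 - p) * z `^ p = l * (z / l) `^ p.
  move=> z0 l0; rewrite powRM ?invr_ge0 ?(ltW l0)// powR_inv ?(ltW l0)// powRB; last first.
    by rewrite (gt_eqF l0) implybT.
  by rewrite powRr1 ?(ltW l0)// mulrAC mulrA.
rewrite !E//.
have kI : Itv.spec (@Itv.num_sem R) (Itv.Real `[0%Z, 1%Z]) k.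
  by apply/and3P; split; rewrite ?num_real// ?bnd_simp ltW.
have H := @convex_powR R p p1 (Itv.Def kI) (x / k) (y / (1 - k)).
have in0 (z l : R) : 0 <= z -> 0 < l -> z / l \in `[0, +oo[%classic.
  by move=> z0 l0; rewrite inE/= in_itv/= ?andbT divr_ge0// ltW.
have {}H := H (in0 x k x0 k0) (in0 y (1 - k) y0 k1').
have cE : x + y = conv (Itv.Def kI) (x / k : R^o) (y / (1 - k) : R^o).
  rewrite -[in LHS](divfK (lt0r_neq0 k0) x) -[in LHS](divfK (lt0r_neq0 k1') y).
  by rewrite [in LHS](mulrC _ k) [in LHS](mulrC _ (1 - k)) convRE.
by rewrite cE (le_trans H)// convRE.
Qed.
End Powers.

Section Estimates.
Context {R : realType}.
Notation mu := (@lebesgue_measure R).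
Implicit Types (f g u h : R -> R) (a b s t x p : R).

Lemma itv_oc_integrable_cst a b (c : R) : mu.-integrable `]a, b] (EFin \o cst c).
Proof.
apply: (@integrableS _ _ _ mu `[a, b]) => //; first exact: subset_itv_oc_cc.
apply: continuous_compact_integrable; first exact: segment_compact.
by apply: continuous_subspaceT => x; exact: cvg_cst.
Qed.

Lemma measurable_powR_norm p (D : set R) f : measurable_fun D f ->
  measurable_fun D (fun x => `|f x| `^ p).
Proof.
move=> mf; apply: (@measurableT_comp _ _ _ _ _ _ (@powR R ^~ p)) => //.
exact: measurableT_comp.
Qed.

Lemma integrable_itvS f a b s t : a <= s -> t <= b ->
  mu.-integrable `]a, b] (EFin \o f) -> mu.-integrable `]s, t] (EFin \o f).
Proof.
move=> sa tb; apply: integrableS => //.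
by apply: subset_itv; rewrite bnd_simp.
Qed.

Lemma Rpos_integrable_itv f s t : mu.-integrable (Rpos R) (EFin \o f) -> 0 <= s ->
  mu.-integrable `]s, t] (EFin \o f).
Proof.
move=> i0 s0; apply: integrableS i0 => //; first exact: measurable_Rpos.
by apply: subset_itv; rewrite bnd_simp.
Qed.

(** Integrate [powR_le_young] and choose [eta] so that the constant term is half
    of the left-hand side. *)
Lemma Rintegral_powR_le g p s t : 1 <= p -> s <= t ->
  mu.-integrable `]s, t] (EFin \o g) ->
  mu.-integrable `]s, t] (EFin \o (fun x => `|g x| `^ p)) ->
  (\int[mu]_(x in `]s, t]) `|g x|) `^ p <=
  2 `^ p * (t - s) `^ (p - 1) * \int[mu]_(x in `]s, t]) (`|g x| `^ p).
Proof.
move=> p1; rewrite le_eqVlt => /predU1P[<-|st] ig igp.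
  rewrite set_itvoc0 !Rintegral_set0 mulr0 powR0//; lra.
set A := \int[mu]_(x in _) _; set J := \int[mu]_(x in _) _.
have L0 : 0 < t - s by rewrite subr_gt0.
have J0 : 0 <= J by apply: Rintegral_ge0 => x _; exact: powR_ge0.
have := @Rintegral_ge0 _ _ _ mu `]s, t]%classic (fun x => `|g x|) (fun x _ => normr_ge0 _).
rewrite -/A le_eqVlt => /predU1P[<-|A0].
  by rewrite powR0 ?mulr_ge0 ?powR_ge0//; lra.
pose eta := A / (2 * (t - s)).
have e0 : 0 < eta by rewrite divr_gt0// mulr_gt0.
have ic := itv_oc_integrable_cst s t.
have iz c : mu.-integrable `]s, t] (EFin \o (fun x => c * `|g x| `^ p)).
  exact: (integrableZl _ _ igp).
have : A <= eta * (t - s) + eta `^ (1 - p) * J.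
  have <- : \int[mu]_(x in `]s, t]) (cst eta x + eta `^ (1 - p) * `|g x| `^ p) =
      eta * (t - s) + eta `^ (1 - p) * J.
    rewrite RintegralD// RintegralZl// Rintegral_cst//= lebesgue_measure_itv/=.
    by rewrite lte_fin st.
  apply: le_Rintegral => //; first exact: integrable_norm.
    exact: (integrableD _ (ic _) (iz _)).
  by move=> x _; exact: powR_le_young.
have -> : eta * (t - s) = A / 2 by rewrite /eta invfM mulrA divfK// gt_eqF.
move=> h.
have {}h : A / 2 <= eta `^ (1 - p) * J by lra.
have {}h : eta `^ (p - 1) * (A / 2) <= J.
  rewrite -[p - 1]opprB powRN mulrC ler_pdivrMr ?powR_gt0//.
  by rewrite [J * _]mulrC.
have E : eta `^ (p - 1) * (A / 2) = (A / 2) `^ p / (t - s) `^ (p - 1).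
  have -> : eta = (A / 2) / (t - s) by rewrite /eta invfM mulrA.
  rewrite powRM ?powR_inv ?invr_ge0 ?(ltW L0)// ?divr_ge0 ?(ltW A0)//.
  rewrite -(@mulr_powRB1 _ (A / 2) p) ?divr_ge0 ?(ltW A0)//; last lra.
  ring.
move: h; rewrite E ler_pdivrMr ?powR_gt0// powRM ?invr_ge0 ?(ltW A0)// powR_inv//.
rewrite ler_pdivrMr ?powR_gt0// => h.
by rewrite (le_trans h)// le_eqVlt; apply/orP; left; apply/eqP; ring.
Qed.

(** Dominated convergence applied to the restrictions of [f] to [`]n, +oo[]. *)
Lemma Rintegral_tail f : mu.-integrable (Rpos R) (EFin \o f) ->
  (forall x, Rpos R x -> 0 <= f x) -> forall e, 0 < e ->
  exists2 S, 0 < S & forall s t, S <= s -> \int[mu]_(x in `]s, t]) f x <= e.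
Proof.
move=> i0 f0 e e0; have mR := @measurable_Rpos R.
pose F n := f \_ (`]n%:R, +oo[ : set R).
have C : \int[mu]_(x in Rpos R) F n x @[n --> \oo] --> \int[mu]_(x in Rpos R) (cst 0 x).
  apply: (@Rdominated_cvg R _ _ _ f) => //.
  - move=> n; apply/measurable_restrict => //.
    have /integrableP[/measurable_EFinP mf _] := i0.
    by apply: measurable_funS mf.
  - move=> x _; apply: cvg_near_cst; near=> n.
    rewrite /F patchE ifF//; apply/negbTE; rewrite notin_setE/= in_itv/= andbT.
    apply/negP; rewrite -leNgt; near: n.
    exists (Num.truncn x).+1 => // n /= hn.
    by rewrite (le_trans (ltW (truncnS_gt x)))// ler_nat.
  - move=> n x Rx; rewrite /F patchE; case: ifPn => _; first by rewrite ger0_norm ?f0.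
    by rewrite normr0 f0.
rewrite Rintegral_cst// mul0r in C.
move/cvgrPdist_le : C => /(_ _ e0)[N _ HN].
exists N.+1%:R => // s t Ns.
have s0 : 0 < s by rewrite (lt_le_trans _ Ns).
have := HN N (leqnn _); rewrite /= sub0r normrN.
have iF : mu.-integrable (Rpos R) (EFin \o F N).
  rewrite -restrict_EFin; apply/integrable_restrict => //.
  apply: integrableS i0 => //; exact: measurableI.
apply: le_trans; apply: le_trans (ler_norm _).
rewrite /Rintegral; apply: fine_le.
- by apply: integrable_fin_num => //; apply: Rpos_integrable_itv => //; exact: ltW.
- exact: integrable_fin_num.
have -> : (\int[mu]_(x in `]s, t]) (f x)%:E = \int[mu]_(x in `]s, t]) (F N x)%:E)%E.
  apply: eq_integral => x; rewrite inE/= in_itv/= => /andP[sx _].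
  rewrite /F patchE mem_set//= in_itv/= andbT (lt_le_trans _ (ltW sx))//.
  by rewrite (lt_le_trans _ Ns)// ltr_nat.
apply: ge0_subset_integral => //.
- by have /integrableP[] := iF.
- move=> x Rx; rewrite lee_fin /F patchE; case: ifPn => // _; exact: f0.
- by move=> x /=; rewrite in_itv/= => /andP[sx _]; apply/RposP; exact: lt_trans sx.
Unshelve. all: by end_near. Qed.

End Estimates.

(** * Oscillation and decay at infinity *)

Section Decay.
Context {R : realType}.
Notation mu := (@lebesgue_measure R).
Implicit Types (f g u h : R -> R) (a s t x p b : R).

(** The integrand of the weighted norms. *)
Definition wpow (p b : R) f x : R := `|f x| `^ p * x `^ b.

Lemma wpow_ge0 p b f x : 0 <= wpow p b f x.
Proof. by rewrite mulr_ge0 ?powR_ge0. Qed.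

Lemma measurable_wpow p b f (D : set R) : measurable D -> measurable_fun D f ->
  measurable_fun D (wpow p b f).
Proof.
move=> mD mf; apply: measurable_funM; last exact: measurable_funTS.
exact: measurable_powR_norm.
Qed.

Lemma continuous_Rpos_measurable u : (forall x, Rpos R x -> {for x, continuous u}) ->
  measurable_fun (Rpos R) u.
Proof.
move=> cu; apply: open_continuous_measurable_fun; first exact: open_Rpos.
by move=> x; rewrite inE => /cu.
Qed.

(** What the estimates use of a function [u] of the weighted Sobolev space and of
    its weak derivative [g]. *)
Record wfun (p b : R) (u g : R -> R) : Prop := WFun {
  wfun_loc : locally_integrable (Rpos R) g ;
  wfun_cont : forall x, Rpos R x -> {for x, continuous u} ;
  wfun_FTC : forall s t, 0 < s -> s <= t ->
    \int[mu]_(x in `]s, t]) g x = u t - u s ;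
  wfun_int : mu.-integrable (Rpos R) (EFin \o wpow p b u) ;
  wfun_dint : mu.-integrable (Rpos R) (EFin \o wpow p b g) }.

Lemma powR_le_base b s x : 0 <= b -> 0 < s -> s <= x -> s `^ b <= x `^ b.
Proof.
by move=> b0 s0 sx; apply: ge0_ler_powR => //; rewrite ?nnegrE ?ltW// (lt_le_trans s0).
Qed.

Lemma integrable_powR_itv p b g s t : 0 <= b -> locally_integrable (Rpos R) g ->
  mu.-integrable (Rpos R) (EFin \o wpow p b g) -> 0 < s ->
  mu.-integrable `]s, t] (EFin \o (fun x => `|g x| `^ p)).
Proof.
move=> b0 lg ig s0.
have i1 : mu.-integrable `]s, t] (EFin \o (fun x => s `^ (- b) * wpow p b g x)).
  have := Rpos_integrable_itv t ig (ltW s0); exact: integrableZl.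
apply: le_integrable i1 => //.
  apply/measurable_EFinP; apply: measurable_powR_norm; have [mg _ _] := lg.
  apply: measurable_funS mg; first exact: measurable_Rpos.
  by apply: subset_itv; rewrite bnd_simp// ltW.
move=> x /=; rewrite in_itv/= => /andP[sx _].
rewrite lee_fin [leLHS]ger0_norm ?powR_ge0// [leRHS]ger0_norm; last first.
  by rewrite mulr_ge0 ?powR_ge0 ?wpow_ge0.
rewrite /wpow mulrCA ler_peMr ?powR_ge0// powRN mulrC ler_pdivlMr ?powR_gt0//.
by rewrite mul1r powR_le_base// ltW.
Qed.

Lemma Rintegral_powR_le_wpow p b g s t : 0 <= b -> locally_integrable (Rpos R) g ->
  mu.-integrable (Rpos R) (EFin \o wpow p b g) -> 0 < s ->
  s `^ b * \int[mu]_(x in `]s, t]) (`|g x| `^ p) <= \int[mu]_(x in `]s, t]) wpow p b g x.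
Proof.
move=> b0 lg ig s0; have igp := integrable_powR_itv t b0 lg ig s0.
rewrite -RintegralZl//; apply: le_Rintegral => //.
- exact: (integrableZl _ _ igp).
- exact: Rpos_integrable_itv (ltW s0).
- move=> x /=; rewrite in_itv/= => /andP[sx _].
  by rewrite mulrC ler_wpM2l ?powR_ge0// powR_le_base// ltW.
Qed.

Lemma le_Rintegral_itv f s t v : (forall x, s < x -> 0 <= f x) ->
  mu.-integrable `]s, v] (EFin \o f) -> s <= t -> t <= v ->
  \int[mu]_(x in `]s, t]) f x <= \int[mu]_(x in `]s, v]) f x.
Proof.
move=> f0 iv st tv.
have := Rintegral_itvB iv (_ : (BRight s <= BRight t)%O) (_ : (BRight t <= BRight v)%O).
rewrite !bnd_simp => /(_ st tv)/eqP; rewrite subr_eq => /eqP ->.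
rewrite lerDr; apply: Rintegral_ge0 => x /=; rewrite in_itv/= => /andP[tx _].
by apply: f0; rewrite (le_lt_trans st).
Qed.

(** On an interval of length at most [s] the Hoelder inequality costs
    [s `^ (p - 1)], and the weight is at least [s `^ b] there; the exponents
    combine to [b - p + 1]. *)
Lemma wfun_oscillation p b u g s t : 1 < p -> p - 1 < b -> wfun p b u g ->
  0 < s -> s <= t -> t <= 2 * s ->
  s `^ (b - p + 1) * `|u t - u s| `^ p <=
  2 `^ p * \int[mu]_(x in `]s, 2 * s]) wpow p b g x.
Proof.
move=> p1 pb [lg cu FTCu iu ig] s0 st ts.
have b0 : 0 <= b by lra.
have p0 : 0 <= p by lra.
have [p10 ts0 tss] : [/\ 0 <= p - 1, 0 <= t - s & t - s <= s] by split; lra.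
have lgi : mu.-integrable `]s, t] (EFin \o g).
  by have := locally_integrable_itv t lg s0; apply: integrableS => //; exact: subset_itv_oc_cc.
have igp := integrable_powR_itv t b0 lg ig s0.
have h1 : `|u t - u s| `^ p <= 2 `^ p * (t - s) `^ (p - 1) * \int[mu]_(x in `]s, t]) (`|g x| `^ p).
  apply: le_trans (Rintegral_powR_le (ltW p1) st lgi igp).
  apply: ge0_ler_powR; rewrite ?nnegrE//; first exact: Rintegral_ge0.
  by rewrite -FTCu//; exact: le_normr_Rintegral.
have J0 : 0 <= \int[mu]_(x in `]s, t]) (`|g x| `^ p).
  by apply: Rintegral_ge0 => x _; exact: powR_ge0.
have h2 : (t - s) `^ (p - 1) <= s `^ (p - 1).
  by apply: ge0_ler_powR; rewrite ?nnegrE// ltW.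
have h3 : s `^ (b - p + 1) * s `^ (p - 1) = s `^ b.
  by rewrite -powRD; [congr (_ `^ _); ring|rewrite (gt_eqF s0) implybT].
apply: (@le_trans _ _ (s `^ (b - p + 1) *
    (2 `^ p * s `^ (p - 1) * \int[mu]_(x in `]s, t]) (`|g x| `^ p)))).
  by rewrite ler_wpM2l ?powR_ge0// (le_trans h1)// ler_wpM2r// ler_wpM2l// powR_ge0.
set J := \int[mu]_(x in _) _ in J0 *.
have -> : s `^ (b - p + 1) * (2 `^ p * s `^ (p - 1) * J) = 2 `^ p * (s `^ b * J).
  by rewrite -h3; ring.
rewrite ler_wpM2l ?powR_ge0// (le_trans (Rintegral_powR_le_wpow t b0 lg ig s0))//.
apply: le_Rintegral_itv => //; first by move=> x _; exact: wpow_ge0.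
exact: Rpos_integrable_itv (ltW s0).
Qed.

(** Bound [`|u s|] by [`|u x|] plus an oscillation, for [x] in [`]s, s + 1]],
    and integrate over [x]; the resulting energies are tails. *)
Lemma wfun_decay p b u g : 1 < p -> p - 1 < b -> wfun p b u g ->
  s `^ ((b - p + 1) / p) * `|u s| @[s --> +oo] --> 0.
Proof.
move=> p1 pb W; have [lg cu FTCu iu ig] := W.
have b0 : 0 <= b by lra.
have p0 : 0 < p by lra.
apply/cvgrPdist_le => e e0.
pose c := (2 : R) `^ p.
have c0 : 0 < c by rewrite powR_gt0.
pose d := e `^ p / (c + c * c).
have d0 : 0 < d by rewrite divr_gt0 ?powR_gt0// addr_gt0// mulr_gt0.
have [S1 S10 H1] := Rintegral_tail iu (fun x _ => wpow_ge0 p b u x) d0.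
have [S2 S20 H2] := Rintegral_tail ig (fun x _ => wpow_ge0 p b g x) d0.
near=> s.
have s1 : 1 <= s by near: s; apply: nbhs_pinfty_ge; exact: num_real.
have sS1 : S1 <= s by near: s; apply: nbhs_pinfty_ge; exact: num_real.
have sS2 : S2 <= s by near: s; apply: nbhs_pinfty_ge; exact: num_real.
have s0 : 0 < s by lra.
rewrite sub0r normrN ger0_norm ?mulr_ge0 ?powR_ge0//.
apply: (@le_powR_cancel _ _ _ p) => //; [by rewrite mulr_ge0 ?powR_ge0|exact: ltW|].
rewrite powRM ?powR_ge0// -powRrM divfK ?gt_eqF//.
set I := \int[mu]_(x in `]s, 2 * s]) wpow p b g x.
have I1 : I <= d by exact: H2.
have key x : `]s, s + 1]%classic x ->
    s `^ (b - p + 1) * `|u s| `^ p <= c * wpow p b u x + c * c * I.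
  rewrite /= in_itv/= => /andP[sx xs].
  have xx : x <= 2 * s by lra.
  have := wfun_oscillation p1 pb W s0 (ltW sx) xx; rewrite -/I -/c => h.
  have tri : `|u s| `^ p <= c * (`|u x| `^ p + `|u x - u s| `^ p).
    apply: le_trans (powRD_le _ _ (ltW p0)) => //.
    apply: ge0_ler_powR; rewrite ?nnegrE ?addr_ge0 ?(ltW p0)//.
    by rewrite -[X in `|X|](subKr (u x)) (le_trans (ler_normB _ _)).
  (* this is where 1 <= s is used: b - p + 1 <= b *)
  have kb : s `^ (b - p + 1) <= x `^ b.
    apply: (@le_trans _ _ (s `^ b)); last exact: powR_le_base (ltW sx).
    by apply: ler_powR => //; lra.
  have : s `^ (b - p + 1) * `|u s| `^ p <=
      s `^ (b - p + 1) * (c * (`|u x| `^ p + `|u x - u s| `^ p)).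
    by rewrite ler_wpM2l ?powR_ge0.
  move=> /le_trans; apply; rewrite mulrCA mulrDr mulrDr -mulrA lerD//; last first.
    by rewrite ler_wpM2l// ltW.
  by rewrite ler_wpM2l ?(ltW c0)// /wpow mulrC ler_wpM2l ?powR_ge0.
have ic := itv_oc_integrable_cst s (s + 1).
have iu1 := Rpos_integrable_itv (s + 1) iu (ltW s0).
have icu : mu.-integrable `]s, s + 1] (EFin \o (fun x => c * wpow p b u x)).
  exact: (integrableZl _ _ iu1).
have ss1 : s < s + 1 by lra.
have mu1 : fine (mu `]s, s + 1]%classic) = 1.
  by rewrite lebesgue_measure_itv/= lte_fin ss1/= addrC addKr.
set L := s `^ _ * _ in key *.
have : \int[mu]_(x in `]s, s + 1]) cst L x <=
    \int[mu]_(x in `]s, s + 1]) (c * wpow p b u x + cst (c * c * I) x).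
  apply: le_Rintegral => //.
  exact: (integrableD _ icu (ic _)).
rewrite RintegralD// RintegralZl// !Rintegral_cst// mu1 !mulr1 => /le_trans; apply.
have U1 := H1 s (s + 1) sS1.
have -> : e `^ p = c * d + c * c * d.
  by rewrite -mulrDl mulrC divfK// gt_eqF// addr_gt0// mulr_gt0.
by rewrite lerD// ler_wpM2l// ?mulr_ge0// ltW.
Unshelve. all: by end_near. Qed.

End Decay.

(** * Hardy's inequality *)

Section Hardy.
Context {R : realType}.
Notation mu := (@lebesgue_measure R).
Implicit Types (f g u h : R -> R) (a s t x p b : R).

(** The factor gained by the scale-invariant size of [u] when [s] is halved:
    with [k] this ratio, [k `^ (1 - p) * 2 `^ (- (b - p + 1)) = k], so that [k]
    also serves as the weight in [powRD_convex]. *)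
Definition hardy_ratio p b : R := 2 `^ (- ((b - p + 1) / p)).

Lemma hardy_ratio_itv p b : 1 < p -> p - 1 < b -> 0 < hardy_ratio p b /\ hardy_ratio p b < 1.
Proof.
move=> p1 pb; have kp : 0 < (b - p + 1) / p by rewrite divr_gt0; lra.
split; first by rewrite powR_gt0.
rewrite /hardy_ratio powRN invf_lt1 ?powR_gt0//.
by have := @gt0_ltr_powR R _ kp 1 2; rewrite !nnegrE powR1; apply; rewrite ?ltr1n.
Qed.

(** Compare [u s] with [u (2 * s)] by [powRD_convex], whose weight is chosen so
    that the coefficient of the first term is smaller than 1. *)
Lemma hardy_step p b u g s : 1 < p -> p - 1 < b -> wfun p b u g -> 0 < s ->
  s `^ (b - p + 1) * `|u s| `^ p <=
  hardy_ratio p b * ((2 * s) `^ (b - p + 1) * `|u (2 * s)| `^ p) +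
  (1 - hardy_ratio p b) `^ (1 - p) * 2 `^ p * \int[mu]_(x in `]s, 2 * s]) wpow p b g x.
Proof.
move=> p1 pb W s0; have [] := hardy_ratio_itv p1 pb; set k := hardy_ratio p b => k0 k1.
have p0 : 0 < p by exact: lt_trans p1.
have s2 : s <= 2 * s by rewrite ler_peMl ?ler1n// ltW.
have := wfun_oscillation p1 pb W s0 s2 (lexx _); set I := \int[mu]_(x in _) _ => h.
have tri : `|u s| `^ p <= k `^ (1 - p) * `|u (2 * s)| `^ p +
    (1 - k) `^ (1 - p) * `|u (2 * s) - u s| `^ p.
  apply: le_trans (powRD_convex _ _ (ltW p1) k0 k1) => //.
  apply: ge0_ler_powR; rewrite ?nnegrE ?addr_ge0 ?(ltW p0)//.
  by rewrite -[X in `|X|](subKr (u (2 * s))) (le_trans (ler_normB _ _)).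
have kk : s `^ (b - p + 1) * k `^ (1 - p) = k * (2 * s) `^ (b - p + 1).
  have -> : k `^ (1 - p) = k * k `^ (- p).
    by rewrite powRD ?(gt_eqF k0) ?implybT// powRr1 ?ltW.
  rewrite powRM ?ltW//.
  have -> : k `^ (- p) = 2 `^ (b - p + 1).
    rewrite /k /hardy_ratio -powRrM; congr (_ `^ _).
    by rewrite mulrN mulNr opprK divfK// gt_eqF.
  ring.
apply: (@le_trans _ _ (s `^ (b - p + 1) * (k `^ (1 - p) * `|u (2 * s)| `^ p +
    (1 - k) `^ (1 - p) * `|u (2 * s) - u s| `^ p))).
  by rewrite ler_wpM2l ?powR_ge0.
rewrite mulrDr mulrA kk -mulrA lerD// mulrCA -mulrA ler_wpM2l ?powR_ge0//.
Qed.

(** Away from 0 the extra factor [t `^ (- p)] is bounded, so that Hardy's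
    inequality concerns only the behaviour at 0. *)
Lemma integrable_wpow_sub p b u s : 1 < p -> mu.-integrable (Rpos R) (EFin \o wpow p b u) ->
  measurable_fun (Rpos R) u -> 0 < s ->
  mu.-integrable `]s, +oo[ (EFin \o wpow p (b - p) u).
Proof.
move=> p1 iu mu_ s0; have p0 : 0 <= p by lra.
have sub : `]s, +oo[ `<=` Rpos R.
  by move=> x /=; rewrite in_itv/= andbT => sx; apply/RposP; exact: lt_trans sx.
have mR := @measurable_Rpos R.
have i1 : mu.-integrable `]s, +oo[ (EFin \o (fun x => s `^ (- p) * wpow p b u x)).
  have : mu.-integrable `]s, +oo[ (EFin \o wpow p b u) by apply: integrableS iu.
  exact: integrableZl.
apply: le_integrable i1 => //.
  apply/measurable_EFinP; apply: measurable_wpow => //.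
  exact: measurable_funS mu_.
move=> x /=; rewrite in_itv/= andbT => sx.
have x0 : 0 < x by exact: lt_trans sx.
rewrite lee_fin [leLHS]ger0_norm ?wpow_ge0// [leRHS]ger0_norm; last first.
  by rewrite mulr_ge0 ?powR_ge0 ?wpow_ge0.
rewrite /wpow mulrCA ler_wpM2l ?powR_ge0// powRD ?(gt_eqF x0) ?implybT// mulrC.
rewrite ler_wpM2r ?powR_ge0// !powRN lef_pV2 ?posrE ?powR_gt0//.
exact: powR_le_base (ltW sx).
Qed.

(** On [`]s, 2s]] the weight [t `^ (b - p)] is at most
    [2 `^ (b - p + 1) * s `^ (b - p + 1) / s], and [u] differs from [u s] by an
    oscillation. *)
Lemma hardy_local p b u g s : 1 < p -> p - 1 < b -> wfun p b u g -> 0 < s ->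
  \int[mu]_(x in `]s, 2 * s]) wpow p (b - p) u x <=
  2 `^ p * 2 `^ (b - p + 1) * (s `^ (b - p + 1) * `|u s| `^ p +
    2 `^ p * \int[mu]_(x in `]s, 2 * s]) wpow p b g x).
Proof.
move=> p1 pb W s0; have [lg cu FTCu iu ig] := W.
have p0 : 0 < p by lra.
have s2 : s < 2 * s by lra.
set I := \int[mu]_(x in `]s, 2 * s]) wpow p b g x.
set N := s `^ _ * _; set c := (2 : R) `^ p; set e := (2 : R) `^ (b - p + 1).
have c0 : 0 <= c by exact: powR_ge0.
have e0 : 0 <= e by exact: powR_ge0.
have s1 : s != 0 by rewrite gt_eqF.
have key x : `]s, 2 * s]%classic x -> wpow p (b - p) u x <= cst (c * e * (N + c * I) / s) x.
  rewrite /= in_itv/= => /andP[sx xs].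
  have x0 : 0 < x by lra.
  have := wfun_oscillation p1 pb W s0 (ltW sx) xs; rewrite -/I -/c => h.
  have tri : `|u x| `^ p <= c * (`|u s| `^ p + `|u x - u s| `^ p).
    apply: le_trans (powRD_le _ _ (ltW p0)) => //.
    apply: ge0_ler_powR; rewrite ?nnegrE ?addr_ge0 ?(ltW p0)//.
    by rewrite -[X in `|X|](subrK (u s)) addrC (le_trans (ler_normD _ _)).
  have kb : x `^ (b - p) <= e * s `^ (b - p + 1) / s.
    have -> : x `^ (b - p) = x `^ (b - p + 1) / x.
      by rewrite [X in _ = X / _]powRD ?(gt_eqF x0) ?implybT// powRr1 ?(ltW x0)// mulfK// gt_eqF.
    have h1 : x `^ (b - p + 1) <= e * s `^ (b - p + 1).
      by rewrite /e -powRM ?(ltW s0)//; apply: powR_le_base => //; lra.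
    have h2 : x^-1 <= s^-1 by rewrite lef_pV2 ?posrE// ltW.
    by rewrite ler_pM ?powR_ge0 ?invr_ge0 ?(ltW x0).
  apply: (@le_trans _ _ (c * (`|u s| `^ p + `|u x - u s| `^ p) * (e * s `^ (b - p + 1) / s))).
    by rewrite /wpow ler_pM ?powR_ge0.
  have -> : c * (`|u s| `^ p + `|u x - u s| `^ p) * (e * s `^ (b - p + 1) / s) =
     c * e * (N + s `^ (b - p + 1) * `|u x - u s| `^ p) / s by rewrite /N; ring.
  by rewrite ler_wpM2r ?invr_ge0 ?(ltW s0)// ler_wpM2l ?mulr_ge0// lerD2l.
have iX : mu.-integrable `]s, 2 * s] (EFin \o wpow p (b - p) u).
  have := integrable_wpow_sub p1 iu (continuous_Rpos_measurable cu) s0.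
  by apply: integrableS => //; apply: subset_itvl; rewrite bnd_simp.
have ic := itv_oc_integrable_cst s (2 * s).
have := le_Rintegral _ iX (ic _) key => /(_ (measurable_itv _)) h.
apply: (le_trans h); rewrite Rintegral_cst//= lebesgue_measure_itv/= lte_fin s2/=.
have -> : 2 * s - s = s by ring.
by rewrite divfK.
Qed.

(** The function [M] of the proof is a discrete Lyapunov function.  The
    coefficient [E] is the solution of [(D + E) * k = E], with [k] the ratio of
    [hardy_step] and [D] the constant of [hardy_local]; then the multiples of
    the size of [u] at [s] and at [2 * s] cancel in [M s <= M (2 * s)], and the
    multiples of the energy of [g] are absorbed by the last term of [M]. *)
Lemma hardy_bounded p b u g : 1 < p -> p - 1 < b -> wfun p b u g ->
  exists C, forall n : nat, \int[mu]_(x in `]2 ^- n, 1]) wpow p (b - p) u x <= C.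
Proof.
move=> p1 pb W; have [lg cu FTCu iu ig] := W.
pose k := hardy_ratio p b.
have [k0 k1] : 0 < k /\ k < 1 by exact: hardy_ratio_itv.
pose D := (2 : R) `^ p * 2 `^ (b - p + 1).
pose c := (2 : R) `^ p.
pose C := (1 - k) `^ (1 - p) * c.
pose N s := s `^ (b - p + 1) * `|u s| `^ p.
pose X s := \int[mu]_(x in `]s, 1]) wpow p (b - p) u x.
pose J s := \int[mu]_(x in `]s, 1]) wpow p b g x.
have D0 : 0 <= D by rewrite mulr_ge0 ?powR_ge0.
have c0 : 0 <= c by exact: powR_ge0.
have C0 : 0 <= C by rewrite mulr_ge0 ?powR_ge0.
have N0 s : 0 <= N s by rewrite mulr_ge0 ?powR_ge0.
pose E := D * k / (1 - k).
have E0 : 0 <= E by rewrite divr_ge0 ?mulr_ge0 ?subr_ge0 ?(ltW k0) ?(ltW k1).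
pose C4 := (D + E) * C + D * c.
pose M s := X s + E * N s - C4 * J s.
have split f s : 0 < s -> 2 * s <= 1 -> mu.-integrable `]s, 1] (EFin \o f) ->
    \int[mu]_(x in `]s, 1]) f x =
    \int[mu]_(x in `]s, 2 * s]) f x + \int[mu]_(x in `](2 * s), 1]) f x.
  move=> s0 s1 i1.
  have := Rintegral_itvB i1 (_ : (BRight s <= BRight (2 * s))%O) (_ : (BRight (2 * s) <= BRight 1)%O).
  rewrite !bnd_simp; have -> : s <= 2 * s by lra.
  move=> /(_ erefl s1)/eqP; rewrite subr_eq => /eqP ->; by rewrite addrC.
have step s : 0 < s -> 2 * s <= 1 -> M s <= M (2 * s).
  move=> s0 s1.
  have iX : mu.-integrable `]s, 1] (EFin \o wpow p (b - p) u).
    have := integrable_wpow_sub p1 iu (continuous_Rpos_measurable cu) s0.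
    by apply: integrableS => //; apply: subset_itvl; rewrite bnd_simp.
  have XE : X s = _ := split _ _ s0 s1 iX.
  have JE : J s = _ := split _ _ s0 s1 (Rpos_integrable_itv 1 ig (ltW s0)).
  have := hardy_step p1 pb W s0; rewrite -/k -/C -/(N s) -/(N (2 * s)).
  have := hardy_local p1 pb W s0; rewrite -/D -/(N s) -/c.
  set I := \int[mu]_(x in `]s, 2 * s]) wpow p b g x in JE *.
  move=> hX hN; rewrite /M JE XE.
  rewrite -/(X (2 * s)) -/(J (2 * s)).
  have DE : (D + E) * k = E by rewrite /E; field; rewrite subr_eq0 gt_eqF.
  have h2 : (D + E) * N s <= (D + E) * (k * N (2 * s) + C * I).
    by rewrite ler_wpM2l ?addr_ge0.
  have h3 : (D + E) * (k * N (2 * s) + C * I) = E * N (2 * s) + (D + E) * C * I.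
    by rewrite mulrDr mulrA DE mulrA.
  rewrite h3 in h2.
  have hX2 : \int[mu]_(x in `]s, 2 * s]) wpow p (b - p) u x <= D * N s + D * c * I.
    by rewrite (le_trans hX)// mulrDr mulrA.
  have h4 : (D + E) * N s = D * N s + E * N s by rewrite mulrDl.
  have h5 : C4 * (I + J (2 * s)) = (D + E) * C * I + D * c * I + C4 * J (2 * s).
    by rewrite /C4; ring.
  rewrite h5; rewrite h4 in h2.
  move: (E * N (2 * s)) ((D + E) * C * I) (D * c * I) (C4 * J (2 * s)) h2 hX2.
  move: (D * N s) (E * N s) (X (2 * s)) (\int[mu]_(x in _) _) => v1 v2 v3 v4 v5 v6 v7 v8 hh1 hh2.
  by lra.
have Mn n : M (2 ^- n) <= M 1.
  elim: n => [|n IH]; first by rewrite expr0 invr1.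
  have e2 : 2 * 2 ^- n.+1 = 2 ^- n :> R.
    by rewrite exprS invfM mulrA mulfV ?mul1r.
  apply: le_trans IH; rewrite -e2; apply: step; first by rewrite invr_gt0 exprn_gt0.
  by rewrite e2 invf_le1 ?exprn_gt0// exprn_ege1// ler1n.
exists (M 1 + C4 * \int[mu]_(x in Rpos R) wpow p b g x) => n.
have n0 : 0 < 2 ^- n :> R by rewrite invr_gt0 exprn_gt0.
have C40 : 0 <= C4 by apply: addr_ge0; apply: mulr_ge0 => //; exact: addr_ge0.
have JT : J (2 ^- n) <= \int[mu]_(x in Rpos R) wpow p b g x.
  rewrite /J /Rintegral; apply: fine_le.
  - by apply: integrable_fin_num => //; apply: Rpos_integrable_itv => //; exact: ltW.
  - by apply: integrable_fin_num => //; exact: measurable_Rpos.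
  - apply: ge0_subset_integral => //.
    + exact: measurable_Rpos.
    + by have /integrableP[] := ig.
    + by move=> x _; rewrite lee_fin wpow_ge0.
    + by move=> x /=; rewrite in_itv/= => /andP[h _]; apply/RposP; exact: lt_trans h.
have := Mn n; rewrite {1}/M -/(X (2 ^- n)) => h.
have h1 : C4 * J (2 ^- n) <= C4 * \int[mu]_(x in Rpos R) wpow p b g x by rewrite ler_wpM2l.
have h2 : 0 <= E * N (2 ^- n) by rewrite mulr_ge0.
lra.
Qed.

(** Monotone convergence on the intervals [`]2 ^- n, 1]]. *)
Theorem hardy p b u g : 1 < p -> p - 1 < b -> wfun p b u g ->
  mu.-integrable (Rpos R) (EFin \o wpow p (b - p) u).
Proof.
move=> p1 pb W; have [lg cu FTCu iu ig] := W.
have [C HC] := hardy_bounded p1 pb W.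
have mu_ := continuous_Rpos_measurable cu.
have mR := @measurable_Rpos R.
have mX : measurable_fun (Rpos R) (EFin \o wpow p (b - p) u).
  by apply/measurable_EFinP; exact: measurable_wpow.
have i1 : mu.-integrable `]1, +oo[ (EFin \o wpow p (b - p) u).
  exact: integrable_wpow_sub.
have RE : Rpos R = (`]0, 1] `|` `]1, +oo[)%classic.
  apply/seteqP; split=> x.
    move=> /RposP x0; have [x1|x1] := leP x 1; [left|right]; by rewrite /= in_itv/= ?x0 ?x1.
  by move=> [|] /=; rewrite in_itv/= => /andP[h _]; apply/RposP; rewrite // (lt_trans _ h).
pose F n := `]2 ^- n, 1 : R]%classic.
have UF : \bigcup_n F n = `]0, 1]%classic.
  apply/seteqP; split=> x.
    move=> [n _]; rewrite /F /= !in_itv/= => /andP[h ->]; rewrite andbT.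
    by apply: lt_trans h; rewrite invr_gt0 exprn_gt0.
  move=> h; move: h; rewrite /= in_itv/= => /andP[x0 x1].
  have [n hn] : exists n : nat, n.+1%:R^-1 < x.
    near \oo => n; exists n; near: n; exact: (near_infty_natSinv_lt (PosNum x0)).
  exists n.+1 => //; rewrite /F /= in_itv/= x1 andbT (lt_trans _ hn)//.
  rewrite ltf_pV2 ?posrE ?exprn_gt0// -natrX ltr_nat.
  exact: ltn_expl.
have le1 : (\int[mu]_(x in `]0%R, 1%R]) (wpow p (b - p) u x)%:E <= C%:E)%E.
  rewrite -UF.
  have cv : (\int[mu]_(x in F n) (wpow p (b - p) u x)%:E)%E @[n --> \oo] -->
     (\int[mu]_(x in \bigcup_n F n) (wpow p (b - p) u x)%:E)%E.
    apply: ge0_nondecreasing_set_cvg_integral => //.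
    - apply/nondecreasing_seqP => n; apply/subsetPset; apply: subset_itvr; rewrite bnd_simp.
      by rewrite lef_pV2 ?posrE ?exprn_gt0// ler_weXn2l ?ler1n.
    - move=> n; exact: measurable_itv.
    - move=> n; apply: measurable_funS mX => // x; rewrite /F /= in_itv/= => /andP[h _].
      by apply/RposP; apply: lt_trans h; rewrite invr_gt0 exprn_gt0.
    - by move=> n x _; rewrite lee_fin wpow_ge0.
  rewrite -(cvg_lim _ cv)//; apply: lime_le; first by apply/cvg_ex; eexists; exact: cv.
  apply: nearW => n.
  have iF : mu.-integrable `]2 ^- n, 1] (EFin \o wpow p (b - p) u).
    have n0 : 0 < 2 ^- n :> R by rewrite invr_gt0 exprn_gt0.
    have := integrable_wpow_sub p1 iu mu_ n0.
    by apply: integrableS => //; apply: subset_itvl; rewrite bnd_simp.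
  rewrite -[X in (X <= _)%E]fineK; last by rewrite /F; apply: (integrable_fin_num _ iF).
  by rewrite lee_fin; exact: HC.
apply/integrableP; split=> //.
have -> : (\int[mu]_(x in Rpos R) `|(EFin \o wpow p (b - p) u) x| =
   \int[mu]_(x in Rpos R) (wpow p (b - p) u x)%:E)%E.
  by apply: eq_integral => x _ /=; rewrite ger0_norm ?wpow_ge0.
rewrite RE ge0_integral_setU//=; last 3 first.
- by rewrite -RE.
- by move=> x _; rewrite lee_fin wpow_ge0.
- apply/disj_setPS => x [] /=; rewrite !in_itv/= andbT => /andP[_ x1].
  by rewrite ltNge x1.
rewrite lte_add_pinfty//; first by rewrite (le_lt_trans le1)// ltry.
have /integrableP[_] := i1; apply: le_lt_trans; rewrite le_eqVlt; apply/orP; left; apply/eqP.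
by apply: eq_integral => x _ /=; rewrite ger0_norm ?wpow_ge0.
Unshelve. all: by end_near. Qed.

End Hardy.

(** * Approximation by smooth functions *)

Section SmoothApprox.
Context {R : realType}.
Notation mu := (@lebesgue_measure R).
Implicit Types (f g u h k : R -> R) (a s t x p b c e : R).

Lemma itv_uniform_continuity f a b e : continuous f -> 0 < e ->
  exists2 d, 0 < d & forall x y, a <= x <= b -> `|x - y| < d -> `|f x - f y| <= e.
Proof.
move=> cf e0.
have /compact_near_coveringP nc := @segment_compact R a b.
have : \forall d \near 0^'+, `[a, b] `<=` [set x | forall y, `|x - y| < d -> `|f x - f y| <= e].
  apply: (nc R (0^'+) (fun d x => forall y, `|x - y| < d -> `|f x - f y| <= e)).
  move=> x _; have e20 : 0 < e / 2 by rewrite divr_gt0.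
  have : f y @[y --> x] --> f x by exact: cf.
  move=> /cvgrPdist_le/(_ _ e20)/nbhs_ballP[r /= r0 Hr].
  exists (ball x (r / 2), [set d | d < r / 2]) => /=.
    split; first by apply: nbhsx_ballx; rewrite divr_gt0.
    by apply: nbhs_right_lt; rewrite divr_gt0.
  move=> [x' d] /= [xx' dr] y x'y.
  rewrite -[f x' - f y](subrKA (f x)) (le_trans (ler_normD _ _))// [leRHS]splitr lerD//.
    rewrite distrC; apply: Hr; apply: le_ball xx'; lra.
  apply: Hr; rewrite /ball/= -[x - y](subrKA x') (le_lt_trans (ler_normD _ _))//.
  by rewrite [ltRHS]splitr ltrD// (lt_trans x'y).
move=> H; near (0 : R)^'+ => d; exists d; first by near: d; exact: nbhs_right_gt.
move=> x y xab; move: x xab y; near: d; apply: filterS H => d H x xab y; apply: H; rewrite /= in_itv.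
Unshelve. all: by end_near. Qed.

(** Subdivide the interval so finely that [f] oscillates by at most [e] on each
    piece, and pass from one node value to the next by a rescaled smooth step;
    the result is a convex combination of two node values on each piece. *)
Lemma smooth_uniform_approx f a b e : continuous f -> a < b -> 0 < e ->
  exists k, [/\ smooth k, (forall x, x <= a - 1 -> k x = 0) &
    forall x, a <= x <= b -> `|f x - k x| <= e].
Proof.
move=> cf ab e0; have [d d0 Hd] := @itv_uniform_continuity f a b e cf e0.
have [N Nd] : exists N : nat, (b - a) / N.+1%:R < d.
  near \oo => N; exists N; rewrite ltr_pdivrMr// mulrC -ltr_pdivrMr//; near: N.
  exists (Num.truncn ((b - a) / d)).+1 => // n /= hn.
  by rewrite (lt_trans (truncnS_gt _))// ltr_nat ltnS; exact: hn.
pose h := (b - a) / N.+1%:R.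
have h0 : 0 < h by rewrite divr_gt0// subr_gt0.
pose z i : R := a + i%:R * h.
have zS i : z i.+1 = z i + h by rewrite /z -natr1 mulrDl mul1r addrA.
have zN : z N.+1 = b by rewrite /z /h [_ * (_ / _)]mulrC divfK ?pnatr_eq0// subrKC.
have z0 : z 0 = a by rewrite /z mul0r addr0.
have za i : a <= z i by rewrite /z lerDl mulr_ge0// ltW.
have zb i : (i <= N.+1)%N -> z i <= b.
  by move=> iN; rewrite -zN /z lerD2l ler_pM2r// ler_nat.
(* induction on the number of pieces; beyond the last node k is constant *)
suff: forall i, (i <= N.+1)%N -> exists k, [/\ smooth k, (forall x, x <= a - 1 -> k x = 0),
    (forall x, z i <= x -> k x = f (z i)) & forall x, a <= x <= z i -> `|f x - k x| <= e].
  by move=> /(_ N.+1 (leqnn _))[k [sk kl _ kf]]; exists k; split=> //; rewrite -zN.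
elim=> [_|i IH iN].
  exists (fun x => f a * sstep (1 * x + (1 - a))); split.
  - by apply: smoothM; [exact: smooth_cst|exact/smooth_affine/smooth_sstep].
  - by move=> x xa; rewrite sstep_le0 ?mulr0//; lra.
  - by move=> x; rewrite z0 => xa; rewrite sstep_ge1 ?mulr1//; lra.
  - move=> x; rewrite z0 => /andP[xa ax].
    have -> : x = a by apply/eqP; rewrite eq_le ax xa.
    by rewrite sstep_ge1 ?mulr1 ?subrr ?normr0 ?(ltW e0)//; lra.
have [k [sk kl kr kf]] := IH (ltnW iN).
pose th x := sstep (h^-1 * x + - (h^-1 * z i)).
have th0 x : x <= z i -> th x = 0.
  by move=> xz; rewrite /th sstep_le0// subr_le0 ler_pM2l// invr_gt0.
have th1 x : z i.+1 <= x -> th x = 1.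
  rewrite zS => xz; rewrite /th sstep_ge1// -mulrBr mulrC ler_pdivlMr// mul1r.
  by rewrite lerBrDl.
exists (fun x => k x + (f (z i.+1) - f (z i)) * th x); split.
- apply: smoothD; first exact: sk.
  apply: smoothM; first exact: smooth_cst.
  exact/smooth_affine/smooth_sstep.
- move=> x xa; rewrite kl// th0 ?mulr0 ?addr0//; have := za i; lra.
- move=> x zx; rewrite th1// mulr1 kr; first by rewrite addrC subrK.
  by apply: le_trans zx; rewrite zS lerDl ltW.
- move=> x /andP[ax xz]; have [xi|xi] := leP x (z i).
    by rewrite th0// mulr0 addr0 kf// ax.
  rewrite kr ?(ltW xi)//.
  have t0 : 0 <= th x by exact: sstep_ge0.
  have t1 : th x <= 1 by exact: sstep_le1.
  have xab : a <= x <= b by rewrite ax (le_trans xz)// zb.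
  have A1 : `|f x - f (z i)| <= e.
    apply: Hd => //; rewrite ger0_norm ?subr_ge0 ?(ltW xi)//.
    by rewrite (le_lt_trans _ Nd)// -/h lerBlDl -zS.
  have A2 : `|f x - f (z i.+1)| <= e.
    apply: Hd => //; rewrite distrC ger0_norm ?subr_ge0//.
    by rewrite (le_lt_trans _ Nd)// -/h zS; lra.
  have -> : f x - (f (z i) + (f (z i.+1) - f (z i)) * th x) =
      (1 - th x) * (f x - f (z i)) + th x * (f x - f (z i.+1)) by ring.
  have t1' : 0 <= 1 - th x by rewrite subr_ge0.
  rewrite (le_trans (ler_normD _ _))//.
  rewrite [`|(1 - th x) * _|]normrM [`|th x * _|]normrM (ger0_norm t0) (ger0_norm t1').
  have -> : e = (1 - th x) * e + th x * e by ring.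
  by rewrite lerD// ler_wpM2l.
Unshelve. all: by end_near. Qed.

(** Vanishing on the left makes [k] integrable on [`]-oo, x]], so that the
    integral over that half-line is an antiderivative at every point. *)
Lemma smooth_primitive k c : smooth k -> (forall x, x <= c -> k x = 0) ->
  exists2 P, smooth P & forall t, is_derive t 1 P (k t).
Proof.
move=> sk k0; have ck := smooth_continuous sk.
pose P x := \int[mu]_(t in [set` Interval -oo%O (BRight x)]) k t.
have ik v : mu.-integrable `]-oo, v] (EFin \o k).
  have : mu.-integrable `[c, v] (EFin \o k).
    by apply: continuous_compact_integrable; [exact: segment_compact|exact: continuous_subspaceT].
  rewrite integrable_mkcond//= restrict_EFin => i1.
  have : mu.-integrable `]-oo, v] (EFin \o (k \_ `[c, v])) by exact: integrableS i1.
  apply: eq_integrable => // x; rewrite inE/= in_itv/= => xv.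
  rewrite patchE; case: ifPn => //; rewrite notin_setE/= in_itv/= xv andbT => /negP.
  by rewrite -ltNge => /ltW/k0 ->.
have dP t : is_derive t 1 P (k t).
  have tt : t < t + 1 by rewrite ltrDl.
  have [d1 d2] := @continuous_FTC1 R k -oo%O t (t + 1) tt (ik _) (ltNyr _) (ck t).
  by apply: DeriveDef; [exact: d1|rewrite -d2 derive1E].
by exists P; [exact: smooth_antiderivative dP sk|exact: dP].
Qed.

End SmoothApprox.

Section LpApprox.
Context {R : realType}.
Notation mu := (@lebesgue_measure R).
Implicit Types (f g u h k : R -> R) (a s t x p b c e M : R).

(** Truncation at height [M].  It does not increase the distance to values of
    absolute value at most [M] ([clip_dist]). *)
Definition clip M x : R := Num.min M (Num.max (- M) x).

Lemma clip_continuous M : continuous (clip M).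
Proof.
move=> x; apply: (@continuous_min R R (cst M) (fun x => Num.max (- M) x)).
  exact: cvg_cst.
apply: (@continuous_max R R (cst (- M)) id); first exact: cvg_cst.
exact: cvg_id.
Qed.

Lemma clip_norm M x : 0 <= M -> `|clip M x| <= M.
Proof.
move=> M0; rewrite /clip ler_norml; apply/andP; split.
  by rewrite le_min le_max lexx/= andbT; lra.
by rewrite ge_min lexx.
Qed.

Lemma clip_id M x : `|x| <= M -> clip M x = x.
Proof.
rewrite ler_norml => /andP[h1 h2]; rewrite /clip max_r// min_r//.
Qed.

Lemma clip_dist M x c : `|x| <= M -> `|x - clip M c| <= `|x - c|.
Proof.
rewrite ler_norml => /andP[h1 h2]; rewrite /clip.
have [hc|] := boolP (c <= - M).
  rewrite max_l// min_r; last lra.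
  by rewrite opprK !ger0_norm; lra.
rewrite -ltNge => /ltW hc; rewrite max_r//.
have [hM|] := boolP (c <= M); first by rewrite min_r.
by rewrite -ltNge => /ltW hM; rewrite min_l// !ler0_norm; lra.
Qed.

Lemma measurable_clip M (D : set R) f : measurable_fun D f ->
  measurable_fun D (fun x => clip M (f x)).
Proof.
move=> mf; apply: (@measurableT_comp _ _ _ _ _ _ (clip M)) => //.
by apply: continuous_measurable; exact: clip_continuous.
Qed.

Lemma itv_oc_integrable_bounded a b f c : measurable_fun `]a, b] f ->
  (forall x, a < x <= b -> `|f x| <= c) -> mu.-integrable `]a, b] (EFin \o f).
Proof.
move=> mf fc; apply: le_integrable (itv_oc_integrable_cst a b c) => //.
  by apply/measurable_EFinP; exact: mf.
move=> x /=; rewrite in_itv/= lee_fin => h.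
by rewrite (le_trans (fc _ h))// ler_norm.
Qed.

Lemma Rintegral_itv_oc_cst a b c : a <= b ->
  \int[mu]_(x in `]a, b]) cst c x = c * (b - a).
Proof.
rewrite le_eqVlt => /predU1P[<-|ab].
  by rewrite set_itvoc0 Rintegral_set0 subrr mulr0.
by rewrite Rintegral_cst//= lebesgue_measure_itv/= lte_fin ab.
Qed.

(** For bounded functions the [L^p] distance is controlled by the [L^1] distance,
    for which continuous functions are dense; clipping keeps the continuous
    approximation bounded. *)
Lemma Lp_approx_bounded p a b g M e : 1 < p -> a < b -> 0 < M ->
  measurable_fun `]a, b] g -> (forall x, a < x <= b -> `|g x| <= M) -> 0 < e ->
  exists k, [/\ smooth k, (forall x, x <= a - 1 -> k x = 0),
    mu.-integrable `]a, b] (EFin \o (fun x => `|g x - k x| `^ p)) &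
    \int[mu]_(x in `]a, b]) (`|g x - k x| `^ p) <= e].
Proof.
move=> p1 ab M0 mg gM e0.
have p0 : 0 < p by lra.
have ba : 0 < b - a by rewrite subr_gt0.
have ig := itv_oc_integrable_bounded mg gM.
pose c2 := (2 : R) `^ p.
have c20 : 0 < c2 by rewrite powR_gt0.
pose A := (2 * M) `^ (p - 1).
have A0 : 0 < A by apply: powR_gt0; apply: mulr_gt0.
pose eta := e / (2 * (c2 * A)).
have eta0 : 0 < eta by rewrite divr_gt0// ?mulr_gt0// ?mulr_gt0.
pose ep := (e / (2 * (c2 * (b - a)))) `^ p^-1.
have q0 : 0 < e / (2 * (c2 * (b - a))) by rewrite divr_gt0// ?mulr_gt0// ?mulr_gt0.
have ep0 : 0 < ep by rewrite powR_gt0.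
have muE : (mu `]a, b] < +oo)%E.
  by rewrite lebesgue_measure_itv/= lte_fin ab -EFinB ltry.
have [c_ [cc ci /fine_cvgP[cfin ccvg]]] :=
  approximation_continuous_integrable (measurable_itv `]a, b]) muE ig.
have {ccvg cfin} [c [cc1 ic cle]] : exists c : R -> R, [/\ continuous c,
    mu.-integrable `]a, b] (EFin \o c) & \int[mu]_(x in `]a, b]) `|g x - c x| <= eta].
  have := ccvg; move=> /cvgrPdist_le/(_ _ eta0)[n _ /(_ n (leqnn _))] /= hn.
  exists (c_ n); split => //.
  by move: hn; rewrite sub0r normrN; apply: le_trans; exact: ler_norm.
have cclip : continuous (fun x => clip M (c x)).
  by move=> x; apply: continuous_comp; [exact: cc1|exact: clip_continuous].
have [k [sk k0 kc]] := smooth_uniform_approx cclip ab ep0.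
have mk : measurable_fun `]a, b] k by apply: continuous_measurable; exact: smooth_continuous sk.
have mcl : measurable_fun `]a, b] (fun x => clip M (c x)) by exact: continuous_measurable.
have igc : mu.-integrable `]a, b] (EFin \o (fun x => `|g x - c x|)).
  by apply: integrable_norm; exact: (integrableB _ ig ic).
have epE : ep `^ p = e / (2 * (c2 * (b - a))).
  by rewrite /ep -powRrM mulVf ?gt_eqF// powRr1// ltW.
have bound x : `]a, b]%classic x ->
    `|g x - k x| `^ p <= c2 * A * `|g x - c x| + cst (c2 * ep `^ p) x.
  rewrite /= in_itv/= => xab; have /andP[ax xb] := xab.
  have h1 : `|g x - clip M (c x)| `^ p <= A * `|g x - c x|.
    rewrite -mulr_powRB1// mulrC ler_pM ?powR_ge0//; last exact/clip_dist/gM.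
    apply: ge0_ler_powR; rewrite ?nnegrE ?subr_ge0 ?(ltW p1) ?mulr_ge0 ?(ltW M0)//.
    rewrite (le_trans (ler_normB _ _))// mulr_natl mulr2n lerD ?gM//.
    exact/clip_norm/ltW.
  have h2 : `|clip M (c x) - k x| `^ p <= ep `^ p.
    apply: ge0_ler_powR; rewrite ?nnegrE ?(ltW p0) ?(ltW ep0)//.
    by apply: kc; rewrite xb ltW.
  apply: (@le_trans _ _ (c2 * (`|g x - clip M (c x)| `^ p + `|clip M (c x) - k x| `^ p))).
    apply: le_trans (powRD_le _ _ (ltW p0)) => //.
    apply: ge0_ler_powR; rewrite ?nnegrE ?addr_ge0 ?(ltW p0)//.
    by rewrite -[g x - k x](subrKA (clip M (c x))) ler_normD.
  rewrite mulrDr lerD//; last by rewrite ler_wpM2l// ltW.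
  by rewrite -mulrA ler_wpM2l// ltW.
have iB : mu.-integrable `]a, b] (EFin \o (fun x => c2 * A * `|g x - c x| + cst (c2 * ep `^ p) x)).
  exact: (integrableD _ (integrableZl _ (c2 * A) igc) (itv_oc_integrable_cst _ _ _)).
have iG : mu.-integrable `]a, b] (EFin \o (fun x => `|g x - k x| `^ p)).
  apply: le_integrable iB => //.
    by apply/measurable_EFinP; apply: measurable_powR_norm; exact: measurable_funB.
  move=> x xab /=; rewrite lee_fin ger0_norm ?powR_ge0//.
  by rewrite (le_trans (bound x xab))// ler_norm.
exists k; split=> //.
apply: (le_trans (le_Rintegral _ iG iB bound)) => //.
rewrite RintegralD//; [|exact: (integrableZl _ _ igc)|exact: itv_oc_integrable_cst].
rewrite RintegralZl// Rintegral_itv_oc_cst ?(ltW ab)// epE.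
have -> : c2 * (e / (2 * (c2 * (b - a)))) * (b - a) = e / 2.
  by field; rewrite !gt_eqF.
have : c2 * A * (\int[mu]_(x in `]a, b]) `|g x - c x|) <= c2 * A * eta.
  by rewrite ler_wpM2l// mulr_ge0// ltW.
have -> : c2 * A * eta = e / 2.
  by rewrite /eta; field; rewrite !gt_eqF.
lra.
Qed.

(** Truncations converge in [L^p] by dominated convergence. *)
Lemma Lp_approx p a b g e : 1 < p -> a < b ->
  measurable_fun `]a, b] g ->
  mu.-integrable `]a, b] (EFin \o (fun x => `|g x| `^ p)) -> 0 < e ->
  exists k, [/\ smooth k, (forall x, x <= a - 1 -> k x = 0),
    mu.-integrable `]a, b] (EFin \o (fun x => `|g x - k x| `^ p)) &
    \int[mu]_(x in `]a, b]) (`|g x - k x| `^ p) <= e].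
Proof.
move=> p1 ab mg igp e0; have p0 : 0 < p by lra.
pose c2 := (2 : R) `^ p.
have c20 : 0 < c2 by rewrite powR_gt0.
pose d := e / (2 * c2).
have d0 : 0 < d by rewrite divr_gt0// ?mulr_gt0// ?mulr_gt0.
pose T n x := clip n.+1%:R (g x).
have mT n : measurable_fun `]a, b] (T n) by exact: measurable_clip.
have cT n x : `|g x - T n x| <= `|g x|.
  rewrite /T; have [h|h] := leP `|g x| n.+1%:R; first by rewrite clip_id// subrr normr0.
  have n0 : 0 <= n.+1%:R :> R by [].
  rewrite /clip; have [g0|] := boolP (0 <= g x).
    move: h; rewrite ger0_norm// => h; rewrite max_r; last lra.
    by rewrite min_l ?(ltW h)// ger0_norm; lra.
  rewrite -ltNge => g0; move: h; rewrite ltr0_norm// => h.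
  rewrite max_l; last lra.
  by rewrite min_r; [rewrite opprK ler0_norm; lra|lra].
have C : \int[mu]_(x in `]a, b]) (`|g x - T n x| `^ p) @[n --> \oo] -->
    \int[mu]_(x in `]a, b]) (cst 0 x).
  apply: (@Rdominated_cvg R _ _ _ (fun x => `|g x| `^ p)) => //.
  - by move=> n; apply: measurable_powR_norm; exact: measurable_funB.
  - move=> x _; apply: cvg_near_cst; near=> n.
    rewrite /T clip_id ?subrr ?normr0 ?powR0 ?gt_eqF//.
    near: n; exists (Num.truncn `|g x|).+1 => // n /= hn.
    by rewrite (le_trans (ltW (truncnS_gt _)))// ler_nat; exact: leqW.
  - move=> n x _; rewrite ger0_norm ?powR_ge0//.
    by apply: ge0_ler_powR; rewrite ?nnegrE ?(ltW p0).
rewrite Rintegral_cst// mul0r in C.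
move/cvgrPdist_le : C => /(_ _ d0)[n _ /(_ n (leqnn _))]; rewrite /= sub0r normrN => Hn.
have Tn x : a < x <= b -> `|T n x| <= n.+1%:R by move=> _; exact: clip_norm.
have n0 : 0 < n.+1%:R :> R by [].
have [k [sk k0 ik kd]] := Lp_approx_bounded p1 ab n0 (mT n) Tn d0.
have mk : measurable_fun `]a, b] k by apply: continuous_measurable; exact: smooth_continuous sk.
have iT : mu.-integrable `]a, b] (EFin \o (fun x => `|g x - T n x| `^ p)).
  apply: le_integrable igp => //.
    by apply/measurable_EFinP; apply: measurable_powR_norm; exact: measurable_funB.
  move=> x _ /=; rewrite lee_fin [leLHS]ger0_norm ?powR_ge0// [leRHS]ger0_norm ?powR_ge0//.
  by apply: ge0_ler_powR; rewrite ?nnegrE ?(ltW p0).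
have iB : mu.-integrable `]a, b]
    (EFin \o (fun x => c2 * (`|g x - T n x| `^ p + `|T n x - k x| `^ p))).
  exact: (integrableZl _ _ (integrableD _ iT ik)).
have bound x : `]a, b]%classic x ->
    `|g x - k x| `^ p <= c2 * (`|g x - T n x| `^ p + `|T n x - k x| `^ p).
  move=> _; apply: le_trans (powRD_le _ _ (ltW p0)) => //.
  apply: ge0_ler_powR; rewrite ?nnegrE ?addr_ge0 ?(ltW p0)//.
  by rewrite -[g x - k x](subrKA (T n x)) ler_normD.
have iG : mu.-integrable `]a, b] (EFin \o (fun x => `|g x - k x| `^ p)).
  apply: le_integrable iB => //.
    by apply/measurable_EFinP; apply: measurable_powR_norm; exact: measurable_funB.
  move=> x xab /=; rewrite lee_fin ger0_norm ?powR_ge0//.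
  by rewrite (le_trans (bound x xab))// ler_norm.
exists k; split=> //.
apply: (le_trans (le_Rintegral _ iG iB bound)) => //.
rewrite RintegralZl//; last exact: (integrableD _ iT ik).
rewrite RintegralD// mulrC -ler_pdivlMr//.
have -> : e / c2 = d + d by rewrite /d; field; rewrite gt_eqF.
apply: lerD kd; exact: le_trans (ler_norm _) Hn.
Unshelve. all: by end_near. Qed.

End LpApprox.

(** * Cut-off and density of the test functions *)

Section Cutoff.
Context {R : realType}.
Notation mu := (@lebesgue_measure R).
Implicit Types (f g u h k : R -> R) (n : nat) (a s t x p b c e M : R).

(** Equal to 1 on [[2 / (n + 1), n + 1]] and to 0 outside
    [[1 / (n + 1), 2 (n + 1)]]. *)
Definition cutoff n t : R :=
  sstep (n.+1%:R * t + -1) * sstep (- n.+1%:R^-1 * t + 2).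

Definition dcutoff n t : R :=
  derive1 sstep (n.+1%:R * t + -1) * n.+1%:R * sstep (- n.+1%:R^-1 * t + 2) +
  sstep (n.+1%:R * t + -1) * (derive1 sstep (- n.+1%:R^-1 * t + 2) * - n.+1%:R^-1).

Lemma smooth_cutoff n : smooth (cutoff n).
Proof. by apply: smoothM; exact/smooth_affine/smooth_sstep. Qed.

Lemma is_derive_cutoff n t : is_derive t 1 (cutoff n) (dcutoff n t).
Proof.
have ds x : is_derive x 1 (@sstep R) (derive1 sstep x) by exact/smooth_derive/smooth_sstep.
apply: is_derive_mulf.
  exact: (@is_derive1_comp _ sstep _ _ _ _ (ds _) (is_derive_affine n.+1%:R (-1) t)).
exact: (@is_derive1_comp _ sstep _ _ _ _ (ds _) (is_derive_affine (- n.+1%:R^-1) 2 t)).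
Qed.

Lemma cutoff_itv n t : 0 <= cutoff n t /\ cutoff n t <= 1.
Proof.
split; first by rewrite mulr_ge0 ?sstep_ge0.
by rewrite mulr_ile1 ?sstep_ge0 ?sstep_le1.
Qed.

Lemma supp_in_cutoff n : supp_in (cutoff n) n.+1%:R^-1 (2 * n.+1%:R).
Proof.
have n0 : 0 < n.+1%:R :> R by [].
move=> t; apply: contraR; rewrite negb_and -!ltNge => /orP[h|h]; apply/eqP; rewrite /cutoff.
  rewrite sstep_le0 ?mul0r// subr_le0 mulrC -ler_pdivlMr// mul1r ltW//.
rewrite [X in _ * X]sstep_le0 ?mulr0// mulNr addrC subr_le0 mulrC ler_pdivlMr//.
exact: ltW.
Qed.

Lemma cutoff_near1 t : 0 < t -> \forall n \near \oo, cutoff n t = 1 /\ dcutoff n t = 0.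
Proof.
move=> t0; near=> n.
have h1 : 2 < n.+1%:R * t.
  rewrite -ltr_pdivrMr//; near: n; exists (Num.truncn (2 / t)).+1 => // n /= hn.
  by rewrite (lt_trans (truncnS_gt _))// ltr_nat ltnS.
have h2 : n.+1%:R^-1 * t < 1.
  rewrite mulrC ltr_pdivrMr// mul1r; near: n; exists (Num.truncn t).+1 => // n /= hn.
  by rewrite (lt_trans (truncnS_gt _))// ltr_nat ltnS.
have h1' : 1 < n.+1%:R * t + -1 by lra.
have h2' : 1 < - n.+1%:R^-1 * t + 2 by rewrite mulNr; move: (n.+1%:R^-1 * t) h2 => q hq; lra.
rewrite /cutoff /dcutoff !sstep_ge1 ?(ltW h1') ?(ltW h2')// !sstep_derive_gt1//.
by rewrite !mul0r !mulr0 addr0 mul1r.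
Unshelve. all: by end_near. Qed.

(** The first step has slope of order [n] for [t] of order [1 / n], the second one
    slope of order [1 / n] for [t] of order [n]. *)
Lemma dcutoff_bound : exists2 K : R, 0 < K & forall n t, 0 < t -> `|dcutoff n t| <= K / t.
Proof.
have [K K0 HK] := @sstep_derive_bounded R.
exists (4 * K); first by rewrite mulr_gt0.
move=> n t t0; have n0 : 0 < n.+1%:R :> R by [].
have z0 : 0 <= 2 * K / t by rewrite divr_ge0 ?(ltW t0)// mulr_ge0// ltW.
have H1 : `|derive1 sstep (n.+1%:R * t + -1) * n.+1%:R| <= 2 * K / t.
  have [h|h] := leP (n.+1%:R * t) 2.
    rewrite normrM (@ger0_norm _ n.+1%:R)// mulrAC mulrC ler_pM// ler_pdivlMr//.
  have h' : 1 < n.+1%:R * t + -1 by lra.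
  by rewrite sstep_derive_gt1// mul0r normr0.
have H2 : `|derive1 sstep (- n.+1%:R^-1 * t + 2) * - n.+1%:R^-1| <= 2 * K / t.
  have [h|h] := leP (n.+1%:R^-1 * t) 2.
    rewrite normrM normrN (@ger0_norm _ n.+1%:R^-1) ?invr_ge0//.
    by rewrite mulrAC mulrC ler_pM ?invr_ge0// ler_pdivlMr.
  have h' : - n.+1%:R^-1 * t + 2 < 0 by rewrite mulNr; move: (n.+1%:R^-1 * t) h => q hq; lra.
  by rewrite sstep_derive_lt0// mul0r normr0.
have -> : 4 * K / t = 2 * K / t + 2 * K / t by ring.
rewrite (le_trans (ler_normD _ _))// lerD// normrM.
  by rewrite (ger0_norm (sstep_ge0 _)) (le_trans _ H1)// ler_piMr// sstep_le1.
by rewrite (ger0_norm (sstep_ge0 _)) (le_trans _ H2)// ler_piMl// sstep_le1.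
Qed.

Lemma wpowD_le p b f h t : 0 <= p ->
  wpow p b (f \+ h) t <= 2 `^ p * (wpow p b f t + wpow p b h t).
Proof.
move=> p0; rewrite /wpow -mulrDl mulrA ler_wpM2r ?powR_ge0//.
apply: le_trans (powRD_le _ _ p0) => //.
by apply: ge0_ler_powR; rewrite ?nnegrE ?addr_ge0// ler_normD.
Qed.

Lemma wpow_le p b f h t : 0 <= p -> `|f t| <= `|h t| -> wpow p b f t <= wpow p b h t.
Proof.
move=> p0 fh; rewrite /wpow ler_wpM2r ?powR_ge0//.
by apply: ge0_ler_powR; rewrite ?nnegrE.
Qed.

Lemma measurable_dcutoff n (D : set R) : measurable_fun D (dcutoff n).
Proof.
rewrite -(derive1_is_derive (is_derive_cutoff n)).
apply: continuous_measurable; apply: smooth_continuous.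
by apply: smooth_derive1; exact: smooth_cutoff.
Qed.

Lemma measurable_cutoff n (D : set R) : measurable_fun D (cutoff n).
Proof. by apply: continuous_measurable; apply: smooth_continuous; exact: smooth_cutoff. Qed.

(** Dominated convergence: the product rule contributes [dcutoff n * u], whose
    energy is dominated by the Hardy integrand thanks to [dcutoff_bound]. *)
Lemma cutoff_approx p b u g e : 1 < p -> p - 1 < b -> wfun p b u g -> 0 < e ->
  exists n, [/\
    mu.-integrable (Rpos R) (EFin \o wpow p b (fun t => (1 - cutoff n t) * u t)),
    \int[mu]_(t in Rpos R) wpow p b (fun t => (1 - cutoff n t) * u t) t <= e,
    mu.-integrable (Rpos R) (EFin \o
      wpow p b (fun t => (1 - cutoff n t) * g t - dcutoff n t * u t)) &
    \int[mu]_(t in Rpos R) wpow p b (fun t => (1 - cutoff n t) * g t - dcutoff n t * u t) t <= e].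
Proof.
move=> p1 pb W e0; have [lg cu FTCu iu ig] := W.
have p0 : 0 < p by lra.
have mR := @measurable_Rpos R.
have mu_ := continuous_Rpos_measurable cu.
have mg : measurable_fun (Rpos R) g by case: lg.
have ih := hardy p1 pb W.
have [K K0 HK] := dcutoff_bound.
pose f1 n := wpow p b (fun t => (1 - cutoff n t) * u t).
pose f2 n := wpow p b (fun t => (1 - cutoff n t) * g t - dcutoff n t * u t).
have mc n : measurable_fun (Rpos R) (fun t => 1 - cutoff n t).
  by apply: measurable_funB; [exact: measurable_cst|exact: measurable_cutoff].
have m1 n : measurable_fun (Rpos R) (f1 n).
  by apply: measurable_wpow => //; exact: measurable_funM.
have m2 n : measurable_fun (Rpos R) (f2 n).
  apply: measurable_wpow => //; apply: measurable_funB; apply: measurable_funM => //.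
  exact: measurable_dcutoff.
pose h1 := wpow p b u.
pose h2 t := 2 `^ p * (wpow p b g t + K `^ p * wpow p (b - p) u t).
have c1 n t : `|1 - cutoff n t| <= 1.
  by have [l1 l2] := cutoff_itv n t; rewrite ger0_norm; lra.
have b1 n t : `|f1 n t| <= h1 t.
  rewrite ger0_norm ?wpow_ge0//; apply: wpow_le; first exact: ltW.
  by rewrite normrM ler_piMl.
have b2 n t : Rpos R t -> `|f2 n t| <= h2 t.
  move=> /RposP t0; rewrite ger0_norm ?wpow_ge0//.
  apply: (le_trans (@wpowD_le p b (fun t => (1 - cutoff n t) * g t)
    (fun t => - (dcutoff n t * u t)) t (ltW p0))).
  rewrite ler_wpM2l ?powR_ge0// lerD//.
    by apply: wpow_le; [exact: ltW|rewrite normrM ler_piMl].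
  rewrite /wpow normrN normrM powRM//.
  have -> : t `^ (b - p) = t `^ b * (t^-1) `^ p.
    by rewrite powRD ?(gt_eqF t0) ?implybT// powRN powR_inv// ltW.
  have -> : K `^ p * (`|u t| `^ p * (t `^ b * t^-1 `^ p)) =
      (K * t^-1) `^ p * `|u t| `^ p * t `^ b.
    by rewrite powRM ?invr_ge0 ?ltW//; ring.
  rewrite ler_wpM2r ?powR_ge0// ler_wpM2r ?powR_ge0//.
  apply: ge0_ler_powR; rewrite ?nnegrE ?(ltW p0)//; last exact: HK.
  by rewrite divr_ge0// ltW.
have i2 : mu.-integrable (Rpos R) (EFin \o h2).
  exact: (integrableZl _ _ (integrableD _ ig (integrableZl _ _ ih))).
have C1 : \int[mu]_(t in Rpos R) f1 n t @[n --> \oo] --> \int[mu]_(t in Rpos R) (cst 0 t).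
  apply: (@Rdominated_cvg R _ _ _ h1) => // t /RposP t0.
  apply: cvg_near_cst; near=> n.
  have [E1 _] : cutoff n t = 1 /\ dcutoff n t = 0 by near: n; exact: cutoff_near1.
  by rewrite /f1 /wpow E1 subrr mul0r normr0 powR0 ?mul0r// gt_eqF.
have C2 : \int[mu]_(t in Rpos R) f2 n t @[n --> \oo] --> \int[mu]_(t in Rpos R) (cst 0 t).
  apply: (@Rdominated_cvg R _ _ _ h2) => // t /RposP t0.
  apply: cvg_near_cst; near=> n.
  have [E1 E2] : cutoff n t = 1 /\ dcutoff n t = 0 by near: n; exact: cutoff_near1.
  by rewrite /f2 /wpow E1 E2 subrr !mul0r subrr normr0 powR0 ?mul0r// gt_eqF.
rewrite Rintegral_cst// mul0r in C1; rewrite Rintegral_cst// mul0r in C2.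
move/cvgrPdist_le : C1 => /(_ _ e0)[N1 _ H1].
move/cvgrPdist_le : C2 => /(_ _ e0)[N2 _ H2].
exists (maxn N1 N2); split.
- apply: le_integrable iu => //; first by apply/measurable_EFinP; exact: m1.
  by move=> t _ /=; rewrite lee_fin (le_trans (b1 _ _))// ler_norm.
- have := H1 (maxn N1 N2) (leq_maxl _ _); rewrite /= sub0r normrN.
  by apply: le_trans; exact: ler_norm.
- apply: le_integrable i2 => //; first by apply/measurable_EFinP; exact: m2.
  by move=> t Rt /=; rewrite lee_fin (le_trans (b2 _ _ Rt))// ler_norm.
- have := H2 (maxn N1 N2) (leq_maxr _ _); rewrite /= sub0r normrN.
  by apply: le_trans; exact: ler_norm.
Unshelve. all: by end_near. Qed.

Lemma integral_majorant f h e : measurable_fun (Rpos R) f ->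
  mu.-integrable (Rpos R) (EFin \o h) -> (forall t, Rpos R t -> 0 <= f t <= h t) ->
  \int[mu]_(t in Rpos R) h t <= e -> (\int[mu]_(t in Rpos R) (f t)%:E <= e%:E)%E.
Proof.
move=> mf ih fh he; have mR := @measurable_Rpos R.
apply: (@le_trans _ _ (\int[mu]_(t in Rpos R) (h t)%:E)%E).
  apply: ge0_le_integral => //.
  - by move=> t Dt; have /andP[f0 _] := fh _ Dt; rewrite lee_fin.
  - by apply/measurable_EFinP; exact: mf.
  - by have /integrableP[] := ih.
  - by move=> t Dt; have /andP[_ fht] := fh _ Dt; rewrite lee_fin.
rewrite -[X in (X <= _)%E]fineK ?lee_fin//.
exact: (integrable_fin_num _ ih).
Qed.

End Cutoff.

Section Density.
Context {R : realType}.
Notation mu := (@lebesgue_measure R).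
Implicit Types (f g u h k : R -> R) (n : nat) (a s t x p b c e v : R).

Lemma integrable_patch_itv f a v : 0 <= a -> mu.-integrable `]a, v] (EFin \o f) ->
  mu.-integrable (Rpos R) (EFin \o (f \_ `]a, v])).
Proof.
move=> a0 i0; have mR := @measurable_Rpos R; rewrite -restrict_EFin; apply/integrable_restrict => //.
rewrite setIidr//; by apply: subset_itv; rewrite bnd_simp.
Qed.

Lemma Rintegral_patch_itv f a v : 0 <= a ->
  \int[mu]_(t in Rpos R) (f \_ `]a, v]) t = \int[mu]_(t in `]a, v]) f t.
Proof.
move=> a0; rewrite -Rintegral_mkcondr setIidr//.
by apply: subset_itv; rewrite bnd_simp.
Qed.

(** [u - P] vanishes at [a] and is the integral of [g - k]. *)
Lemma primitive_dist p g k u P a v d : 1 < p -> 0 < a -> a < v ->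
  locally_integrable (Rpos R) g ->
  (forall s t, 0 < s -> s <= t -> \int[mu]_(x in `]s, t]) g x = u t - u s) ->
  smooth k -> smooth P -> derive1 P = k -> P a = u a ->
  mu.-integrable `]a, v] (EFin \o (fun x => `|g x - k x| `^ p)) ->
  \int[mu]_(x in `]a, v]) (`|g x - k x| `^ p) <= d ->
  forall t, a < t <= v -> `|u t - P t| `^ p <= 2 `^ p * (v - a) `^ (p - 1) * d.
Proof.
move=> p1 a0 av lg FTCu sk sP dP Pa ip id t /andP[at_ tv].
have p0 : 0 < p by lra.
have ta : 0 <= t - a by lra.
have p10 : 0 <= p - 1 by lra.
have tva : t - a <= v - a by lra.
have va : 0 <= v - a by lra.
have oc f w : mu.-integrable `[a, w] (EFin \o f) -> mu.-integrable `]a, w] (EFin \o f).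
  by apply: integrableS => //; exact: subset_itv_oc_cc.
have ig : mu.-integrable `]a, t] (EFin \o g) by apply: oc; exact: locally_integrable_itv.
have ck := smooth_continuous sk.
have ik' : mu.-integrable `[a, t] (EFin \o k).
  by apply: continuous_compact_integrable; [exact: segment_compact|exact: continuous_subspaceT].
have ik := oc _ _ ik'.
have igk : mu.-integrable `]a, t] (EFin \o (fun x => g x - k x)).
  exact: (integrableB _ ig ik).
have ip' : mu.-integrable `]a, t] (EFin \o (fun x => `|g x - k x| `^ p)).
  exact: integrable_itvS ip.
have E : u t - P t = \int[mu]_(x in `]a, t]) (g x - k x).
  rewrite RintegralB// FTCu ?(ltW at_)//.
  have -> : \int[mu]_(x in `]a, t]) k x = P t - P a.
    by rewrite Rintegral_itv_obnd_cbnd// -dP smooth_FTC2.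
  by rewrite Pa; ring.
apply: (@le_trans _ _ ((\int[mu]_(x in `]a, t]) `|g x - k x|) `^ p)).
  apply: ge0_ler_powR; rewrite ?nnegrE ?(ltW p0)//; first exact: Rintegral_ge0.
  by rewrite E; exact: le_normr_Rintegral.
apply: (le_trans (Rintegral_powR_le (ltW p1) (ltW at_) igk ip')).
have J0 : 0 <= \int[mu]_(x in `]a, t]) (`|g x - k x| `^ p).
  by apply: Rintegral_ge0 => x _; exact: powR_ge0.
rewrite ler_pM ?mulr_ge0 ?powR_ge0//.
  by rewrite ler_wpM2l ?powR_ge0//; apply: ge0_ler_powR.
apply: le_trans id; apply: (le_Rintegral_itv _ ip (ltW at_) tv) => x _.
exact: powR_ge0.
Qed.

(** With [chi] the cut-off and [P] an antiderivative of [k], the test function is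
    [phi = chi * P], and
    [u - phi = (1 - chi) u + chi (u - P)],
    [g - phi' = ((1 - chi) g - chi' u) + (chi (g - k) + chi' (u - P))].
    The first terms are small by [cutoff_approx].  The second ones live on a
    fixed compact interval, on which [L^p] closeness of [k] to [g] makes them
    small; so [n] is fixed before [k]. *)
Theorem wfun_density p b u g e : 1 < p -> p - 1 < b -> wfun p b u g -> 0 < e ->
  exists phi, [/\ C0infty phi,
    (\int[mu]_(t in Rpos R) (wpow p b (u \- phi) t)%:E <= e%:E)%E &
    (\int[mu]_(t in Rpos R) (wpow p b (g \- derive1 phi) t)%:E <= e%:E)%E].
Proof.
move=> p1 pb W e0; have [lg cu FTCu iu ig] := W.
have p0 : 0 < p by lra.
have b0 : 0 <= b by lra.
pose c2 : R := 2 `^ p.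
have c20 : 0 < c2 by rewrite powR_gt0.
have e10 : 0 < e / (2 * c2) by rewrite divr_gt0// mulr_gt0.
have [n [ia1 a1 ia2 a2]] := cutoff_approx p1 pb W e10.
pose N : R := n.+1%:R.
have N1 : 1 <= N by rewrite ler1n.
have N0 : 0 < N by [].
(* a lies below the support of the cut-off, which thus is contained in the
   half-open interval on which k approximates g *)
pose a := N^-1 / 2; pose v := 2 * N.
have NV0 : 0 < N^-1 by rewrite invr_gt0.
have NV1 : N^-1 <= 1 by rewrite invf_le1.
have a0 : 0 < a by rewrite divr_gt0.
have aN : a < N^-1 by rewrite /a ltr_pdivrMr// ltr_pMr// ltr1n.
have v0 : 0 < v by rewrite mulr_gt0.
have av : a < v.
  by rewrite (lt_trans aN)// (le_lt_trans NV1)// /v (@lt_le_trans _ _ 2)// ?ltr1n// ler_peMr.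
pose chi := @cutoff R n.
have chis t : chi t != 0 -> a < t <= v.
  by move=> /supp_in_cutoff /andP[h1 h2]; rewrite h2 (lt_le_trans aN h1).
have dchis t : dcutoff n t != 0 -> a < t <= v.
  rewrite -(derive1_is_derive (@is_derive_cutoff R n)) => h.
  have /andP[h1 h2] := supp_in_derive1 (@supp_in_cutoff R n) h.
  by rewrite h2 (lt_le_trans aN h1).
have [K K0 HK] := @dcutoff_bound R.
pose K1 := K / a.
have K10 : 0 < K1 by rewrite divr_gt0.
have dK t : a < t -> `|dcutoff n t| <= K1.
  move=> at_; have t0 := lt_trans a0 at_.
  by rewrite (le_trans (HK n t t0))// ler_wpM2l ?(ltW K0)// lef_pV2 ?posrE// ltW.
pose L := v - a.
have L0 : 0 < L by rewrite subr_gt0.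
pose B := v `^ b.
have B0 : 0 < B by rewrite powR_gt0.
have tB t : a < t <= v -> t `^ b <= B.
  by move=> /andP[h1 h2]; apply: powR_le_base => //; exact: lt_trans h1.
pose c1 := c2 * L `^ (p - 1).
have c10 : 0 < c1 by rewrite mulr_gt0 ?powR_gt0.
(* A1 * d and A2 * d bound the energies of the second terms *)
pose A1 := B * c1 * L.
pose A2 := c2 * B * (1 + K1 `^ p * c1 * L).
have A10 : 0 < A1 by apply: mulr_gt0 => //; exact: mulr_gt0.
have A20 : 0 < A2.
  apply: mulr_gt0; [exact: mulr_gt0|apply: addr_gt0 => //].
  by apply: mulr_gt0 => //; apply: mulr_gt0 => //; exact: powR_gt0.
pose d := e / (2 * c2 * (A1 + A2)).
have d0 : 0 < d.
  apply: divr_gt0 => //; apply: mulr_gt0; [exact: mulr_gt0|exact: addr_gt0].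
have dA : (A1 + A2) * d = e / (2 * c2).
  by rewrite /d; field; rewrite !gt_eqF// addr_gt0.
have eh : e / c2 = e / (2 * c2) + e / (2 * c2) by field; rewrite gt_eqF.
have mg : measurable_fun `]a, v] g.
  have := @locally_integrable_measurable R g a v lg a0; apply: measurable_funS => //.
  exact: subset_itv_oc_cc.
have igp := integrable_powR_itv v b0 lg ig a0.
have [k [sk k0 ik kd]] := Lp_approx p1 av mg igp d0.
have [P0 sP0 dP0] := smooth_primitive sk k0.
pose P t := P0 t + (u a - P0 a).
have dP t : is_derive t 1 P (k t).
  have dc : is_derive t 1 (cst (u a - P0 a) : R -> R) 0 by exact: is_derive_cst.
  by have := is_derive_addf (dP0 t) dc; rewrite addr0.
have sP : smooth P by exact: smooth_antiderivative dP sk.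
have Pa : P a = u a by rewrite /P addrC subrK.
have uP := primitive_dist p1 a0 av lg FTCu sk sP (derive1_is_derive dP) Pa ik kd.
rewrite -/c2 -/L -/c1 in uP.
pose phi t := chi t * P t.
have sphi : smooth phi by apply: smoothM; [exact: smooth_cutoff|exact: sP].
have cphi : C0infty phi.
  apply: smooth_C0infty a0 sphi (_ : supp_in phi a v) => t.
  by rewrite mulf_eq0 negb_or => /andP[/chis/andP[h1 h2] _]; rewrite h2 ltW.
have dphi : derive1 phi = (fun t => dcutoff n t * P t + chi t * k t).
  by apply: derive1_is_derive => t; apply: is_derive_mulf => //; exact: is_derive_cutoff.
have mR := @measurable_Rpos R.
have mu_ := continuous_Rpos_measurable cu.
have mg' : measurable_fun (Rpos R) g by case: lg.
have [chi0 chi1] : (forall t, 0 <= chi t) /\ (forall t, chi t <= 1).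
  by split=> t; have [] := @cutoff_itv R n t.
have nchi t : `|chi t| <= 1 by rewrite ger0_norm.
exists phi; split => //.
- pose h t := c2 * (wpow p b (fun t => (1 - chi t) * u t) t + (cst (c1 * d * B) \_ `]a, v]) t).
  have iG := integrable_patch_itv (ltW a0) (itv_oc_integrable_cst a v (c1 * d * B)).
  have ih : mu.-integrable (Rpos R) (EFin \o h).
    exact: (integrableZl _ _ (integrableD _ ia1 iG)).
  apply: (integral_majorant _ ih).
  + apply: measurable_wpow => //; apply: measurable_funB => //.
    by apply: continuous_measurable; exact: smooth_continuous.
  + move=> t _; rewrite wpow_ge0/=.
    have -> : u \- phi = (fun t => (1 - chi t) * u t) \+ (fun t => chi t * (u t - P t)).
      by apply/funext => x /=; rewrite /phi; ring.
    apply: (le_trans (wpowD_le _ _ _ _ (ltW p0))).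
    rewrite /h ler_wpM2l ?(ltW c20)// lerD2l patchE; case: ifPn => [|] tav.
      move: tav; rewrite inE/= in_itv/= => tav.
      rewrite /wpow/= ler_pM ?powR_ge0 ?tB//.
      apply: le_trans (uP _ tav); apply: ge0_ler_powR; rewrite ?nnegrE ?(ltW p0)//.
      by rewrite normrM ler_piMl.
    have ct : chi t = 0.
      by apply/eqP; apply: contraNT tav => /chis h1; rewrite inE/= in_itv.
    by rewrite /wpow ct mul0r normr0 powR0 ?mul0r// gt_eqF.
  + rewrite RintegralZl//; last exact: (integrableD _ ia1 iG).
    rewrite RintegralD// Rintegral_patch_itv ?(ltW a0)// Rintegral_itv_oc_cst ?(ltW av)//.
    rewrite mulrC -ler_pdivlMr// eh; apply: (lerD a1).
    rewrite (_ : c1 * d * B * (v - a) = A1 * d).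
      by rewrite -dA ler_wpM2r ?(ltW d0)// lerDl ltW.
    by rewrite /A1 /L; ring.
- pose G t := c2 * B * (`|g t - k t| `^ p + cst (K1 `^ p * (c1 * d)) t).
  pose h t := c2 * (wpow p b (fun t => (1 - chi t) * g t - dcutoff n t * u t) t +
    (G \_ `]a, v]) t).
  have iGo : mu.-integrable `]a, v] (EFin \o G).
    exact: (integrableZl _ (c2 * B) (integrableD _ ik (itv_oc_integrable_cst _ _ _))).
  have iG := integrable_patch_itv (ltW a0) iGo.
  have ih : mu.-integrable (Rpos R) (EFin \o h).
    exact: (integrableZl _ _ (integrableD _ ia2 iG)).
  rewrite dphi; apply: (integral_majorant _ ih).
  + apply: measurable_wpow => //; apply: measurable_funB => //.
    rewrite -dphi; apply: continuous_measurable; apply: smooth_continuous.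
    exact: smooth_derive1.
  + move=> t _; rewrite wpow_ge0/=.
    have -> : g \- (fun t => dcutoff n t * P t + chi t * k t) =
        (fun t => (1 - chi t) * g t - dcutoff n t * u t) \+
        (fun t => chi t * (g t - k t) + dcutoff n t * (u t - P t)).
      by apply/funext => x /=; ring.
    apply: (le_trans (wpowD_le _ _ _ _ (ltW p0))).
    rewrite /h ler_wpM2l ?(ltW c20)// lerD2l patchE; case: ifPn => [|] tav.
      move: tav; rewrite inE/= in_itv/= => tav; have /andP[at_ tv] := tav.
      apply: (le_trans (@wpowD_le R p b (fun t => chi t * (g t - k t))
        (fun t => dcutoff n t * (u t - P t)) t (ltW p0))).
      rewrite /G -mulrA ler_wpM2l ?(ltW c20)// /wpow -mulrDl [leRHS]mulrC.
      rewrite ler_pM ?addr_ge0 ?powR_ge0 ?tB//; apply: lerD.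
        by apply: ge0_ler_powR; rewrite ?nnegrE ?(ltW p0)// normrM ler_piMl.
      rewrite normrM powRM// ler_pM ?powR_ge0//; last exact: uP.
      by apply: ge0_ler_powR; rewrite ?nnegrE ?(ltW p0) ?(ltW K10)// dK.
    have ct : chi t = 0.
      by apply/eqP; apply: contraNT tav => /chis h1; rewrite inE/= in_itv.
    have dct : dcutoff n t = 0.
      by apply/eqP; apply: contraNT tav => /dchis h1; rewrite inE/= in_itv.
    by rewrite /wpow ct dct !mul0r addr0 normr0 powR0 ?mul0r// gt_eqF.
  + rewrite RintegralZl//; last exact: (integrableD _ ia2 iG).
    rewrite RintegralD// Rintegral_patch_itv ?(ltW a0)//.
    rewrite /G RintegralZl//; last exact: (integrableD _ ik (itv_oc_integrable_cst _ _ _)).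
    rewrite RintegralD//; last exact: itv_oc_integrable_cst.
    rewrite Rintegral_itv_oc_cst ?(ltW av)//.
    rewrite mulrC -ler_pdivlMr// eh; apply: (lerD a2); rewrite -dA.
    apply: (@le_trans _ _ (A2 * d)); last by rewrite ler_wpM2r ?(ltW d0)// lerDr ltW.
    have -> : A2 * d = c2 * B * (d + K1 `^ p * (c1 * d) * (v - a)) by rewrite /A2 /L; ring.
    by rewrite ler_wpM2l ?lerD2r// mulr_ge0 ?ltW.
Qed.

End Density.

(** * The function spaces *)

Section Spaces.
Context {R : realType}.
Notation mu := (@lebesgue_measure R).
Implicit Types (f g u h k : R -> R) (n : nat) (a s t x p b c e v : R).

Lemma weak_deriveP u : W11loc u -> is_weak_derive u (weak_derive u).
Proof. by move=> [_ _ ex]; exact: xgetPex. Qed.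

Lemma lty_integrable_wpow p b f : measurable_fun (Rpos R) f ->
  (\int[mu]_(t in Rpos R) (wpow p b f t)%:E < +oo)%E ->
  mu.-integrable (Rpos R) (EFin \o wpow p b f).
Proof.
move=> mf lt; apply/integrableP; split.
  by apply/measurable_EFinP; apply: measurable_wpow => //; exact: measurable_Rpos.
by under eq_integral do rewrite /= ger0_norm ?wpow_ge0//.
Qed.

Lemma integrable_wpow_lty p b f : mu.-integrable (Rpos R) (EFin \o wpow p b f) ->
  (\int[mu]_(t in Rpos R) (wpow p b f t)%:E < +oo)%E.
Proof. by move=> i0; apply: integrable_lty => //; exact: measurable_Rpos. Qed.

Lemma W11loc_wfun p b u : 1 < p -> W11loc u ->
  (\int[mu]_(t in Rpos R) (wpow p b u t)%:E < +oo)%E ->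
  (\int[mu]_(t in Rpos R) (wpow p b (weak_derive u) t)%:E < +oo)%E ->
  wfun p b u (weak_derive u).
Proof.
move=> p1 Wu fu fg; have [lu cu _] := Wu; have wd := weak_deriveP Wu.
have [lg _] := wd; split=> //.
- move=> s t s0 st; exact: (weak_derive_FTC lu cu wd s0 st).
- by apply: lty_integrable_wpow => //; exact: continuous_Rpos_measurable.
- by apply: lty_integrable_wpow => //; case: lg.
Qed.

Lemma Wspace_wfun p b u : 1 < p -> Wspace p b u -> wfun p b u (weak_derive u).
Proof.
move=> p1 [Wu]; rewrite /Wnorm => fin.
have pV : p^-1 != 0 by rewrite invr_eq0 gt_eqF//; lra.
apply: W11loc_wfun => //; apply: (lty_poweRy pV); apply: le_lt_trans fin.
  by rewrite leeDl// poweR_ge0.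
by rewrite leeDr// poweR_ge0.
Qed.

Lemma poweR_inv_le p d (x : \bar R) : 0 < p -> 0 <= d -> (0 <= x)%E ->
  (x <= (d `^ p)%:E)%E -> (x `^ p^-1 <= d%:E)%E.
Proof.
move=> p0 d0; case: x => [x| |]//=; rewrite !lee_fin => x0 xd.
have pV : 0 <= p^-1 by rewrite invr_ge0 ltW.
have := @ge0_ler_powR R _ pV x (d `^ p); rewrite !nnegrE => /(_ x0 (powR_ge0 _ _) xd).
by rewrite -powRrM mulfV ?gt_eqF// powRr1.
Qed.

(** [Wnorm] involves some weak derivative of [u - phi], which agrees almost
    everywhere with the difference of the derivatives. *)
Lemma Wspace_W0space p b u : 1 < p -> p - 1 < b -> Wspace p b u -> W0space p b u.
Proof.
move=> p1 pb Wu; have W := Wspace_wfun p1 Wu; have [Wl _] := Wu.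
have [lu cu _] := Wl; have wd := weak_deriveP Wl.
have p0 : 0 < p by lra.
split=> // e e0.
have d0 : 0 < e / 3 by rewrite divr_gt0.
have d1 : 0 < (e / 3) `^ p by rewrite powR_gt0.
have [phi [cphi h1 h2]] := wfun_density p1 pb W d1.
exists phi => //.
have [sphi _] := C0infty_smooth cphi.
have cphi' := smooth_continuous sphi.
have lphi := continuous_locally_integrable cphi'.
have wB := weak_deriveB lu lphi wd (weak_derive_smooth sphi).
have lB := locally_integrableB lu lphi.
have cB t : Rpos R t -> {for t, continuous (u \- phi)}.
  by move=> Rt; apply: continuousB; [exact: cu|exact: cphi'].
have wd2 : is_weak_derive (u \- phi) (weak_derive (u \- phi)).
  by apply: xgetPex; eexists; exact: wB.
have ae := weak_derive_unique lB cB wd2 wB.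
have mR := @measurable_Rpos R.
have E : (\int[mu]_(t in Rpos R) (wpow p b (weak_derive (u \- phi)) t)%:E =
    \int[mu]_(t in Rpos R) (wpow p b (weak_derive u \- derive1 phi) t)%:E)%E.
  have [[m1 _ _] _] := wd2; have [[m2 _ _] _] := wB.
  apply: ge0_ae_eq_integral => //.
  - by apply/measurable_EFinP; exact: measurable_wpow.
  - by apply/measurable_EFinP; exact: measurable_wpow.
  - by move=> x _; rewrite lee_fin wpow_ge0.
  - by move=> x _; rewrite lee_fin wpow_ge0.
  - apply: filterS ae; first exact: (ae_filter_ringOfSetsType mu).
    by move=> x Hx Rx; rewrite /wpow Hx.
have int0 f : (0 <= \int[mu]_(t in Rpos R) (wpow p b f t)%:E)%E.
  by apply: integral_ge0 => x _; rewrite lee_fin wpow_ge0.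
have hA := poweR_inv_le p0 (ltW d0) (int0 _) h1.
have hB := poweR_inv_le p0 (ltW d0) (int0 _) h2; rewrite -E in hB.
by apply: le_lt_trans (leeD hA hB) _; rewrite -EFinD lte_fin; lra.
Qed.

Lemma Wspace_decay p b u : 1 < p -> p - 1 < b -> Wspace p b u ->
  t `^ ((b - p + 1) / p) * `|u t| @[t --> +oo] --> (0 : R).
Proof. by move=> p1 pb Wu; exact: wfun_decay (Wspace_wfun p1 Wu). Qed.

Lemma Wspace_cvg0 p b u : 1 < p -> p - 1 < b -> Wspace p b u ->
  u t @[t --> +oo] --> (0 : R).
Proof.
move=> p1 pb Wu; apply/cvgrPdist_le => e e0.
have /cvgrPdist_le/(_ _ e0) H := Wspace_decay p1 pb Wu.
near=> t.
have t1 : 1 <= t by near: t; apply: nbhs_pinfty_ge; exact: num_real.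
have : `|0 - t `^ ((b - p + 1) / p) * `|u t| | <= e by near: t; exact: H.
rewrite !sub0r !normrN ger0_norm ?mulr_ge0 ?powR_ge0//; apply: le_trans.
have k0 : 0 <= (b - p + 1) / p by rewrite divr_ge0//; lra.
by rewrite ler_peMl// -[leLHS](powRr0 t) ler_powR.
Unshelve. all: by end_near. Qed.

Lemma Wspace_Ainfty p b u : 1 < p -> p - 1 < b -> Wspace p b u -> Ainfty p b u.
Proof.
move=> p1 pb Wu; split=> //; exists (fun n => n.+1%:R).
have cy : n.+1%:R @[n --> \oo] --> (+oo : set_system R).
  apply/cvgryPge => A; exists (Num.truncn A).+1 => // n /= hn.
  by rewrite (le_trans (ltW (truncnS_gt _)))// ler_nat; exact: leqW.
split=> //.
- by move=> n; apply/RposP.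
- by move=> m n mn; rewrite ler_nat ltnS.
- exact: cvg_comp cy (Wspace_cvg0 p1 pb Wu).
Unshelve. all: by end_near. Qed.

Lemma Wspace_Cinfty p b u : 1 < p -> p - 1 < b -> Wspace p b u -> Cinfty p b u.
Proof.
move=> p1 pb Wu; split=> //; apply/norm_cvg0P.
apply: cvg_trans (Wspace_decay p1 pb Wu); apply: near_eq_cvg; near=> t.
by rewrite normrM [in RHS]mulrC (ger0_norm (powR_ge0 _ _)).
Unshelve. all: by end_near. Qed.

(** The extra weight of [Ynorm] adds exactly the Hardy integrand. *)
Lemma wpow_hardyE p b u t : 0 < t ->
  `|u t| `^ p * t `^ b * (1 + 1 / t `^ p) = wpow p b u t + wpow p (b - p) u t.
Proof.
by move=> t0; rewrite /wpow powRB ?(gt_eqF t0) ?implybT//; ring.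
Qed.

Lemma Wspace_Yspace p b u : 1 < p -> p - 1 < b -> Wspace p b u -> Yspace p b u.
Proof.
move=> p1 pb Wu; have W := Wspace_wfun p1 Wu; have [Wl _] := Wu; split=> //.
have [lg cu FTCu iu ig] := W.
rewrite /Ynorm lte_add_pinfty//; apply: poweR_lty; last exact: integrable_wpow_lty ig.
have -> : (\int[mu]_(t in Rpos R) (`|u t| `^ p * t `^ b * (1 + 1 / t `^ p))%:E =
   \int[mu]_(t in Rpos R) ((EFin \o wpow p b u) \+ (EFin \o wpow p (b - p) u)) t)%E.
  by apply: eq_integral => t; rewrite inE => /RposP t0; rewrite wpow_hardyE.
apply: integrable_lty; first exact: measurable_Rpos.
apply: integrableD => //; first exact: measurable_Rpos.
exact: hardy p1 pb W.
Qed.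

Lemma Yspace_Wspace p b u : 1 < p -> Yspace p b u -> Wspace p b u.
Proof.
move=> p1 [Wl]; rewrite /Ynorm => fin; split=> //.
have p0 : 0 < p by lra.
have pV : p^-1 != 0 by rewrite invr_eq0 gt_eqF.
have [lu cu _] := Wl; have mu_ := continuous_Rpos_measurable cu.
have mR := @measurable_Rpos R.
rewrite /Wnorm; apply: le_lt_trans fin; rewrite leeD2r//.
apply: gt0_ler_poweR.
- by rewrite invr_ge0 ltW.
- by rewrite in_itv/= leey andbT integral_ge0// => t _; rewrite lee_fin mulr_ge0 ?powR_ge0.
- rewrite in_itv/= leey andbT integral_ge0// => t _.
  by rewrite lee_fin !mulr_ge0 ?powR_ge0// addr_ge0// divr_ge0 ?powR_ge0.
have m1 : measurable_fun (Rpos R) (fun t => `|u t| `^ p * t `^ b) by exact: measurable_wpow.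
apply: ge0_le_integral => //.
- by move=> t _; rewrite lee_fin wpow_ge0.
- by apply/measurable_EFinP; exact: m1.
- apply/measurable_EFinP.
  apply: (@eq_measurable_fun _ _ _ _ _ (fun t => wpow p b u t + wpow p (b - p) u t)).
    by move=> t; rewrite inE => /RposP t0; rewrite wpow_hardyE.
  by apply: measurable_funD; exact: measurable_wpow.
- move=> t _; rewrite lee_fin ler_peMr ?mulr_ge0 ?powR_ge0//.
  by rewrite lerDl divr_ge0 ?powR_ge0.
Qed.

End Spaces.
Unset Implicit Arguments.
Set Strict Implicit.

Theorem theorem4p2 (R : realType) (p b : R) (hp : 1 < p) (hb : p - 1 < b) :
  [/\ Wspace p b = W0space p b,
      W0space p b = Ainfty p b,
      Ainfty p b = Binfty p b,
      Binfty p b = Cinfty p b &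
      Cinfty p b = Yspace p b] /\
  (forall u : R -> R, Wspace p b u ->
     cvg (u t @[t --> +oo]) /\ Trinfty u = 0) /\
  (forall u : R -> R, Wspace p b u ->
     t `^ ((b - (p - 1)) / p) * `|u t| @[t --> +oo] --> (0 : R)).
Proof.
have eqW (S : set (R -> R)) : (forall u, Wspace p b u -> S u) ->
    (forall u, S u -> Wspace p b u) -> S = Wspace p b.
  by move=> h1 h2; apply/seteqP; split=> u; [exact: h2|exact: h1].
have E0 : W0space p b = Wspace p b.
  by apply: eqW => [u|u []//]; exact: Wspace_W0space.
have EA : Ainfty p b = Wspace p b.
  by apply: eqW => [u|u []//]; exact: Wspace_Ainfty.
have EB : Binfty p b = Wspace p b.
  by apply: eqW => [u Wu|u []//]; split=> //; exact: Wspace_cvg0 Wu.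
have EC : Cinfty p b = Wspace p b.
  by apply: eqW => [u|u []//]; exact: Wspace_Cinfty.
have EY : Yspace p b = Wspace p b.
  by apply: eqW => u; [exact: Wspace_Yspace|exact: Yspace_Wspace].
rewrite E0 EA EB EC EY; split; first by split.
split=> u Wu.
  have c0 := Wspace_cvg0 hp hb Wu; split; first by apply/cvg_ex; exists 0.
  exact: (cvg_lim _ c0).
have -> : b - (p - 1) = b - p + 1 by rewrite opprB addrA addrAC.
exact: Wspace_decay Wu.
Qed.
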